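(* Let $\gamma\in(0,1]$, $\beta=\frac{2}{2-\gamma}$ and $c_\beta:=(2/\beta^2)^{\beta/2}$. Then for every $c\in\mathbb{R}$ there are exactly two admissible profiles $\phi_c^+,\phi_c^-$ with speed $c$ such that: (a) $\phi_c^+=0$ in $(-\infty,0]$, $(\phi_c^+)'>0$ in $(0,\infty)$; this profile satisfies $\phi_c^+(\xi)\to\infty$ as $\xi\to\infty$, and: if $c=0$, $\phi_0^+(\xi)=c_\beta\xi_+^\beta$; if $c>0$, $\phi_c^+(\xi)\sim\big(\frac{2\gamma}{\beta c}\xi\big)^{\beta/2}$ as $\xi\to\infty$; if $c<0$, $\phi_c^+(\xi)\sim k e^{-c\xi}$ as $\xi\to+\infty$ for some constant $k>0$; (b) $\phi_c^-=0$ in $[0,\infty)$, $(\phi_c^-)'<0$ in $(-\infty,0)$; this profile satisfies $\phi_c^-(\xi)\to\infty$ as $\xi\to-\infty$, and: if $c=0$, $\phi_0^-(\xi)=c_\beta(-\xi)_+^\beta$; if $c>0$, $\phi_c^-(\xi)\sim k e^{-c\xi}$ as $\xi\to-\infty$ for some constant $k>0$; if $c<0$, $\phi_c^-(\xi)\sim\big(\frac{2\gamma}{\beta|c|}|\xi|\big)^{\beta/2}$ as $\xi\to-\infty$. Furthermore, for every admissible profile $\psi_c$ with speed $c$ there are $a,b\in\{0,1\}$ with $a^2+b^2\ne0$ and $\xi_\pm\in\mathbb{R}$ with $\xi_-\le\xi_+$ such that $\psi_c(\xi)=a\,\phi_c^+(\xi-\xi_+)+b\,\phi_c^-(\xi-\xi_-)$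 for all $\xi\in\mathbb{R}$.
   Context: Given $c\in\mathbb{R}$, an admissible profile with speed $c$ is a continuous function $\phi:\mathbb{R}\to[0,\infty)$ which is neither identically zero nor everywhere positive, is $C^2$ on the open set $\{\phi>0\}$, satisfies $c\phi'+\phi''=\gamma\phi^{\gamma-1}$ in $\{\phi>0\}$, and satisfies the free boundary condition $\lim_{\xi\to\xi_0,\ \xi\in\{\phi>0\}}|(\phi^{1/\beta})'(\xi)|=\frac{\sqrt2}{\beta}$ for every $\xi_0\in\partial\{\phi>0\}$. (These correspond to traveling waves $u(x,t)=\phi(e\cdot x-ct)$.) $\xi_+=\max\{\xi,0\}$; $f\sim g$ means $f/g\to1$. *)

(* Defs.v *)
From Stdlib Require Import Reals Lra.
From Coquelicot Require Import Coquelicot.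
Open Scope R_scope.

(* power with the convention 0^y = 0 (used only for nonnegative bases, y > 0) *)
Definition pw (x y : R) : R := if Rle_dec x 0 then 0 else Rpower x y.

Definition beta (g : R) : R := 2 / (2 - g).
Definition c_beta (g : R) : R := Rpower (2 / (beta g ^ 2)) (beta g / 2).

Definition posset (phi : R -> R) : R -> Prop := fun x => 0 < phi x.

Definition in_boundary (phi : R -> R) (x0 : R) : Prop :=
  (forall eps : R, 0 < eps -> exists x, Rabs (x - x0) < eps /\ 0 < phi x) /\
  ~ (exists eps : R, 0 < eps /\ forall x, Rabs (x - x0) < eps -> 0 < phi x).

Definition admissible (g c : R) (phi : R -> R) : Prop :=
  (forall x, continuous phi x) /\
  (forall x, 0 <= phi x) /\
  (exists x, phi x <> 0) /\
  (exists x, ~ (0 < phi x)) /\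
  (forall x, 0 < phi x ->
     ex_derive phi x /\ ex_derive (Derive phi) x /\
     continuous (Derive (Derive phi)) x) /\
  (forall x, 0 < phi x ->
     c * Derive phi x + Derive (Derive phi) x = g * Rpower (phi x) (g - 1)) /\
  (forall x0, in_boundary phi x0 ->
     filterlim (fun x => Rabs (Derive (fun y => pw (phi y) (1 / beta g)) x))
       (within (posset phi) (locally x0)) (locally (sqrt 2 / beta g))).

Definition equiv_pinf (f h : R -> R) : Prop :=
  filterlim (fun x => f x / h x) (Rbar_locally p_infty) (locally 1).
Definition equiv_minf (f h : R -> R) : Prop :=
  filterlim (fun x => f x / h x) (Rbar_locally m_infty) (locally 1).

Definition shape_plus (phi : R -> R) : Prop :=
  (forall x, x <= 0 -> phi x = 0) /\
  (forall x, 0 < x -> ex_derive phi x /\ 0 < Derive phi x).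

Definition shape_minus (phi : R -> R) : Prop :=
  (forall x, 0 <= x -> phi x = 0) /\
  (forall x, x < 0 -> ex_derive phi x /\ Derive phi x < 0).

Definition asymp_plus (g c : R) (phi : R -> R) : Prop :=
  filterlim phi (Rbar_locally p_infty) (Rbar_locally p_infty) /\
  (c = 0 -> forall x, phi x = c_beta g * pw (Rmax x 0) (beta g)) /\
  (0 < c -> equiv_pinf phi
              (fun x => pw (2 * g / (beta g * c) * x) (beta g / 2))) /\
  (c < 0 -> exists k, 0 < k /\ equiv_pinf phi (fun x => k * exp (- c * x))).

Definition asymp_minus (g c : R) (phi : R -> R) : Prop :=
  filterlim phi (Rbar_locally m_infty) (Rbar_locally p_infty) /\
  (c = 0 -> forall x, phi x = c_beta g * pw (Rmax (- x) 0) (beta g)) /\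
  (0 < c -> exists k, 0 < k /\ equiv_minf phi (fun x => k * exp (- c * x))) /\
  (c < 0 -> equiv_minf phi
              (fun x => pw (2 * g / (beta g * Rabs c) * Rabs x) (beta g / 2))).

(* Main.v *)
Require Import Defs.
From Stdlib Require Import Reals Lra Lia IndefiniteDescription FunctionalExtensionality.
From Coquelicot Require Import Coquelicot.
Open Scope R_scope.

(** Put [v = phi ^ (1 / beta)] and [s = v ^ (beta - 1)]. Along a profile vanishing at its left end,
    [phi'] is a function [p] of [v] with [p p' = 2 s s' - c beta s p] and [p 0 = 0]. This singular
    problem has a positive solution, squeezed between explicit sub- and supersolutions that force
    [p / (beta s) -> sqrt 2 / beta] at [0], and the increasing profile is recovered by inverting the
    travel time [int dv / (p / (beta s))].

    Rigidity: for any admissible [psi] on an interval [(l, r)] with [psi l = 0], the defect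
    [D = psi' - p (v)] satisfies [D' = - kappa D] with [kappa > 0], while the free boundary condition
    gives [D -> 0] at [l]; hence [D = 0], so [psi] is a translate of the profile and never
    returns to [0]. Decreasing profiles are reflections with speed [- c], and the two kinds of
    half-lines are the only possible components of the positivity set. *)

(** * Real analysis *)

(** For [g < 1] the forcing [g phi ^ (g - 1)] is singular at the free boundary, so [phi] does not
    come from a regular initial value problem posed there. The power [1 / beta] is the one for which
    the free boundary condition says that [v] leaves [0] with the finite nonzero slope
    [a = sqrt 2 / beta]. For [c = 0] the phase equation is solved by [p = sqrt 2 s], and the
    barriers perturb this solution: [sqrt 2 s / (1 + B v)] from below, [s (sqrt 2 + beta k v)] from
    above, with [k = max (0, - c)]. The constant [B = |c| beta / (sqrt 2 (beta - 1))] lets the lower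
    barrier absorb the drift. For [c > 0] it is also exact at infinity: the resulting lower bound
    for [v v'] tends to [a / B], the true limit, so that only the upper half of the asymptotics has
    to be proved anew. The upper barrier bounds [v'] linearly in [v], which excludes blow-up at a
    finite point and makes the profile global. *)

Lemma continuous_pt (f : R -> R) (x : R) : continuous f x -> continuity_pt f x.
Proof. intros H; apply continuity_pt_filterlim; exact H. Qed.

Lemma is_derive_continuous (f : R -> R) (x l : R) : is_derive f x l -> continuous f x.
Proof. intros H. apply (ex_derive_continuous f). now exists l. Qed.

Lemma continuous_eps (f : R -> R) (x : R) :
  (forall eps, 0 < eps -> exists d, 0 < d /\
     forall y, Rabs (y - x) < d -> Rabs (f y - f x) < eps) ->
  continuous f x.
Proof.
intros H. apply filterlim_locally. intros eps.
destruct (H eps (cond_pos eps)) as [d [Hd Hy]].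
exists (mkposreal d Hd). intros y By. exact (Hy y By).
Qed.

Lemma eps_continuous (f : R -> R) (x : R) : continuous f x ->
  forall eps, 0 < eps -> exists d, 0 < d /\
     forall y, Rabs (y - x) < d -> Rabs (f y - f x) < eps.
Proof.
intros H eps He.
destruct (proj1 (filterlim_locally f (f x)) H (mkposreal eps He)) as [d Hd].
exists d. split. apply cond_pos. intros y Hy. exact (Hd y Hy).
Qed.

Lemma locally_gt (P : R -> Prop) (x y : R) : x < y -> (forall z, x < z -> P z) -> locally y P.
Proof. intros Hxy H. apply (locally_interval P y x p_infty); simpl; auto. Qed.

Lemma locally_lt (P : R -> Prop) (x y : R) : y < x -> (forall z, z < x -> P z) -> locally y P.
Proof. intros Hxy H. apply (locally_interval P y m_infty x); simpl; auto. Qed.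

Lemma continuous_Rmax_const (c x : R) : continuous (fun y => Rmax c y) x.
Proof.
apply continuous_eps. intros eps He. exists eps. split; [exact He|].
intros y. unfold Rmax.
destruct (Rle_dec c y); destruct (Rle_dec c x); unfold Rabs;
  repeat destruct Rcase_abs; lra.
Qed.

Lemma mean_value (f df : R -> R) (a b : R) : a < b ->
  (forall x, a < x < b -> is_derive f x (df x)) ->
  (forall x, a <= x <= b -> continuous f x) ->
  exists x, a < x < b /\ f b - f a = df x * (b - a).
Proof.
intros Hab Hd Hc.
assert (pr1 : forall x, a < x < b -> derivable_pt f x).
{ intros x Hx. exists (df x). apply is_derive_Reals, Hd, Hx. }
assert (pr2 : forall x, a < x < b -> derivable_pt id x).
{ intros x _. apply derivable_pt_id. }
destruct (MVT f id a b pr1 pr2 Hab) as [x [Hx E]].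
- intros x Hx. apply continuous_pt, Hc, Hx.
- intros x _. apply derivable_continuous_pt, derivable_pt_id.
- exists x. split; [exact Hx|].
  rewrite (derive_pt_eq_0 f x (df x) (pr1 x Hx)) in E
    by (apply is_derive_Reals, Hd, Hx).
  rewrite (derive_pt_eq_0 id x 1 (pr2 x Hx)) in E by apply derivable_pt_lim_id.
  unfold id in E. lra.
Qed.

Lemma nondecreasing_of_derive (f : R -> R) (a b : R) : a <= b ->
  (forall x, a < x < b -> exists l, is_derive f x l /\ 0 <= l) ->
  (forall x, a <= x <= b -> continuous f x) -> f a <= f b.
Proof.
intros Hab Hd Hc.
destruct (Rle_lt_or_eq_dec a b Hab) as [Hlt| ->]; [|lra].
destruct (mean_value f (Derive f) a b Hlt) as [x [Hx E]].
- intros x Hx. destruct (Hd x Hx) as [l [Hl _]].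
  rewrite (is_derive_unique _ _ _ Hl). exact Hl.
- exact Hc.
- destruct (Hd x Hx) as [l [Hl Hp]]. rewrite (is_derive_unique _ _ _ Hl) in E.
  assert (0 <= l * (b - a)) by (apply Rmult_le_pos; lra). lra.
Qed.

(** Squaring removes the corner of the negative part: the remainder of the first-order expansion is
    at most [h ^ 2], on whichever sides of [0] the points [x] and [x + h] lie. *)
Lemma is_derive_sqr_Rmin_0 (x : R) :
  is_derive (fun y => (Rmin y 0) ^ 2) x (2 * Rmin x 0).
Proof.
apply is_derive_Reals. intros eps He. exists (mkposreal eps He).
intros h Hh Hhe. simpl in Hhe.
replace (((Rmin (x + h) 0) ^ 2 - (Rmin x 0) ^ 2) / h - 2 * Rmin x 0)
  with (((Rmin (x + h) 0) ^ 2 - (Rmin x 0) ^ 2 - 2 * h * Rmin x 0) / h)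
  by (field; exact Hh).
unfold Rdiv. rewrite Rabs_mult, Rabs_inv.
apply Rmult_lt_reg_r with (Rabs h); [now apply Rabs_pos_lt|].
rewrite Rmult_assoc, Rinv_l, Rmult_1_r by (now apply Rabs_no_R0).
apply Rle_lt_trans with (Rabs h * Rabs h).
2:{ apply Rmult_lt_compat_r; [now apply Rabs_pos_lt|exact Hhe]. }
rewrite <- Rabs_mult, (Rabs_right (h * h)) by nra.
apply Rabs_le. unfold Rmin.
destruct (Rle_dec (x + h) 0); destruct (Rle_dec x 0); nra.
Qed.

(* The square of the negative part of [D] is nonincreasing. *)
Lemma barrier (D : R -> R) (a b : R) : a <= b -> 0 <= D a ->
  (forall x, a <= x <= b -> continuous D x) ->
  (forall x, a < x < b -> D x < 0 -> exists l, is_derive D x l /\ 0 <= l) ->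
  (forall x, a < x < b -> ex_derive D x) ->
  0 <= D b.
Proof.
intros Hab Ha Hc Hd He.
assert (H : - (Rmin (D a) 0) ^ 2 <= - (Rmin (D b) 0) ^ 2).
{ apply (nondecreasing_of_derive (fun x => - (Rmin (D x) 0) ^ 2) a b Hab).
  - intros x Hx. destruct (He x Hx) as [l Hl].
    exists (- (l * (2 * Rmin (D x) 0))). split.
    + apply (is_derive_opp (fun x => (Rmin (D x) 0) ^ 2)).
      apply (is_derive_comp (fun y => (Rmin y 0) ^ 2) D); [|exact Hl].
      apply is_derive_sqr_Rmin_0.
    + unfold Rmin. destruct (Rle_dec (D x) 0) as [H0|H0]; [|lra].
      destruct (Rle_lt_or_eq_dec _ _ H0) as [H1|H1]; [|rewrite H1; lra].
      destruct (Hd x Hx H1) as [l' [Hl' Hp]].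
      rewrite <- (is_derive_unique _ _ _ Hl), (is_derive_unique _ _ _ Hl').
      nra.
  - intros x Hx. apply (continuous_opp (fun x => (Rmin (D x) 0) ^ 2)).
    apply (continuous_comp D (fun y => (Rmin y 0) ^ 2)); [now apply Hc|].
    eapply is_derive_continuous, is_derive_sqr_Rmin_0. }
rewrite (Rmin_right (D a) 0) in H by exact Ha.
unfold Rmin in H. destruct (Rle_dec (D b) 0) as [H0|H0]; [|lra].
assert (D b ^ 2 <= 0) by lra. nra.
Qed.

(** Meant for an explicit [H], here an exponential: an integral estimate then reduces to
    differentiating the majorant. *)
Lemma Rabs_RInt_le_increment (h H dH : R -> R) (t : R) : 0 <= t ->
  (forall s, 0 <= s <= t -> continuous h s) ->
  (forall s, 0 <= s <= t -> is_derive H s (dH s)) ->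
  (forall s, 0 <= s <= t -> continuous dH s) ->
  (forall s, 0 <= s <= t -> Rabs (h s) <= dH s) ->
  Rabs (RInt h 0 t) <= H t - H 0.
Proof.
intros Ht Hc Hd HcH Hb.
assert (I1 : is_RInt dH 0 t (H t - H 0)).
{ apply (is_RInt_derive H dH); intros s; rewrite Rmin_left, Rmax_right by lra; auto. }
assert (I0 : ex_RInt h 0 t).
{ apply (ex_RInt_continuous h); intros s; rewrite Rmin_left, Rmax_right by lra; auto. }
apply Rle_trans with (1 := abs_RInt_le h 0 t Ht I0).
rewrite <- (is_RInt_unique _ _ _ _ I1).
apply RInt_le; [exact Ht| |now exists (H t - H 0)|intros s Hs; apply Hb; lra].
apply (ex_RInt_continuous (fun s => Rabs (h s))).
intros s; rewrite Rmin_left, Rmax_right by lra; intros Hs.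
now apply (continuous_Rabs_comp h), Hc.
Qed.

(** The limit comes with a rate that depends on [C] alone. When [x] carries a parameter and [C] does
    not, this is uniform convergence. *)
Lemma geometric_cauchy (x : nat -> R) (C : R) :
  (forall n, Rabs (x (S n) - x n) <= C * (/2) ^ n) ->
  is_lim_seq x (real (Lim_seq x)) /\
  forall n, Rabs (real (Lim_seq x) - x n) <= 2 * C * (/2) ^ n.
Proof.
intros H.
assert (HC : 0 <= C).
{ generalize (Rabs_pos (x 1%nat - x 0%nat)) (H 0%nat). simpl. lra. }
assert (Hp : forall n, 0 < (/2) ^ n) by (intros n; apply pow_lt; lra).
(* The factor [1 - (/2) ^ k] is the partial geometric sum; keeping it lets the induction on [k]
   close. *)
assert (Hk : forall n k, Rabs (x (n + k)%nat - x n) <= 2 * C * (/2) ^ n * (1 - (/2) ^ k)).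
{ intros n k. induction k as [|k IH].
  - rewrite Nat.add_0_r, Rminus_diag, Rabs_R0. simpl. lra.
  - replace (n + S k)%nat with (S (n + k)) by lia.
    replace (x (S (n + k)) - x n)
      with ((x (S (n + k)) - x (n + k)%nat) + (x (n + k)%nat - x n)) by ring.
    apply Rle_trans with (1 := Rabs_triang _ _).
    generalize (H (n + k)%nat). rewrite pow_add. simpl pow at 3.
    intros H1. replace ((/2) ^ S k) with (/ 2 * (/2) ^ k) by reflexivity. lra. }
assert (Hk' : forall n k, Rabs (x (n + k)%nat - x n) <= 2 * C * (/2) ^ n).
{ intros n k. apply Rle_trans with (1 := Hk n k).
  rewrite <- (Rmult_1_r (2 * C * (/2) ^ n)) at 2.
  apply Rmult_le_compat_l.
  - generalize (Hp n). intros. apply Rmult_le_pos; lra.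
  - generalize (Hp k); lra. }
assert (L0 : is_lim_seq (fun n => 2 * C * (/2) ^ n) 0).
{ replace (Finite 0) with (Rbar_mult (2 * C) 0) by (simpl; f_equal; ring).
  apply is_lim_seq_scal_l, is_lim_seq_geom. rewrite Rabs_right; lra. }
assert (L : is_lim_seq x (real (Lim_seq x))).
{ apply Lim_seq_correct', ex_lim_seq_cauchy_corr. intros eps.
  apply is_lim_seq_spec in L0. destruct (L0 (pos_div_2 eps)) as [N HN].
  exists N. intros n m Hn Hm. specialize (HN N (Nat.le_refl N)). simpl in HN.
  rewrite Rminus_0_r in HN. apply Rabs_lt_between in HN.
  generalize (Hk' N (n - N)%nat) (Hk' N (m - N)%nat).
  replace (N + (n - N))%nat with n by lia. replace (N + (m - N))%nat with m by lia.
  intros A B. apply Rabs_le_between in A. apply Rabs_le_between in B.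
  apply Rabs_lt_between. lra. }
split; [exact L|]. intros n.
assert (L' : is_lim_seq (fun k => Rabs (x (k + n)%nat - x n)) (Rabs (real (Lim_seq x) - x n))).
{ apply (is_lim_seq_abs (fun k => x (k + n)%nat - x n) (real (Lim_seq x) - x n)).
  apply is_lim_seq_minus'; [|apply is_lim_seq_const].
  now apply (is_lim_seq_incr_n x n). }
assert (B := fun h => is_lim_seq_le _ _ _ _ h L' (is_lim_seq_const (2 * C * (/2) ^ n))).
apply B. intros k. rewrite Nat.add_comm. apply Hk'.
Qed.

(** * Global solutions of scalar initial value problems *)

(** [Rmax 0 t] freezes each iterate at its value at [0] for negative times, so that the iterates are
    continuous on the whole line and one-sided continuity never occurs. *)
Fixpoint picard_iter (f : R -> R -> R) (n : nat) (t : R) : R :=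
  match n with
  | O => 0
  | S m => RInt (fun s => f s (picard_iter f m s)) 0 (Rmax 0 t)
  end.

Lemma continuous_RInt_upper (h : R -> R) (t : R) : (forall s, continuous h s) ->
  continuous (fun x => RInt h 0 x) t.
Proof.
intros Hh. apply (continuous_RInt_1 h 0 t). apply filter_forall. intros z.
apply (RInt_correct h), (ex_RInt_continuous h). intros; apply Hh.
Qed.

Lemma picard_iter_continuous (f : R -> R -> R)
  (Hf : forall p : R * R, continuous (fun q : R * R => f (fst q) (snd q)) p)
  (n : nat) (t : R) : continuous (picard_iter f n) t.
Proof.
revert t. induction n as [|n IH]; intros t; simpl.
- apply continuous_const.
- apply (continuous_comp (fun t => Rmax 0 t)
    (fun x => RInt (fun s => f s (picard_iter f n s)) 0 x)).
  + apply continuous_Rmax_const.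
  + apply continuous_RInt_upper. intros s.
    apply (continuous_comp_2 (fun s => s) (picard_iter f n) f);
      [apply continuous_id|apply IH|apply Hf].
Qed.

Lemma picard_iter_Rmax (f : R -> R -> R) (n : nat) (t : R) :
  picard_iter f n (Rmax 0 t) = picard_iter f n t.
Proof.
destruct n as [|n]; [reflexivity|]. simpl. f_equal.
apply Rmax_right, Rmax_l.
Qed.

Lemma picard_iter_step (f : R -> R -> R)
  (Hf : forall p : R * R, continuous (fun q : R * R => f (fst q) (snd q)) p)
  (T L : R) (HL : forall s x y, 0 <= s <= T -> Rabs (f s x - f s y) <= L * Rabs (x - y)) :
  0 < L -> 0 <= T ->
  exists C, forall n t, t <= T ->
    Rabs (picard_iter f (S n) t - picard_iter f n t) <= C * (/2) ^ n.
Proof.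
intros L0 T0.
assert (Hc : forall n s, continuous (fun s => f s (picard_iter f n s)) s).
{ intros n s. apply (continuous_comp_2 (fun s => s) (picard_iter f n) f);
    [apply continuous_id|now apply picard_iter_continuous|apply Hf]. }
destruct (continuity_ab_maj (fun s => Rabs (picard_iter f 1 s)) 0 T T0) as [m [Hm _]].
{ intros s _. apply continuous_pt, (continuous_Rabs_comp (picard_iter f 1)).
  now apply picard_iter_continuous. }
set (K := Rabs (picard_iter f 1 m)) in Hm.
assert (HK : 0 <= K) by apply Rabs_pos.
(* In the norm weighted by [exp (2 L t)] one Picard step contracts by [1/2] on all of [[0, T]],
   however large [L T] is. *)
assert (B : forall n t, 0 <= t <= T ->
  Rabs (picard_iter f (S n) t - picard_iter f n t) <= K * (/2) ^ n * exp (2 * L * t)).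
{ induction n as [|n IH]; intros t Ht.
  - simpl pow. simpl (picard_iter f 0 t). rewrite Rminus_0_r, Rmult_1_r.
    apply Rle_trans with (1 := Hm t Ht).
    rewrite <- (Rmult_1_r K) at 1. apply Rmult_le_compat_l; [exact HK|].
    apply Rle_trans with (1 + 2 * L * t); [|apply exp_ineq1_le].
    assert (0 <= L * t) by (apply Rmult_le_pos; lra). lra.
  - change (picard_iter f (S (S n)) t)
      with (RInt (fun s => f s (picard_iter f (S n) s)) 0 (Rmax 0 t)).
    change (picard_iter f (S n) t)
      with (RInt (fun s => f s (picard_iter f n s)) 0 (Rmax 0 t)).
    rewrite Rmax_right by lra.
    assert (E := RInt_minus (fun s => f s (picard_iter f (S n) s))
              (fun s => f s (picard_iter f n s)) 0 t
              (ex_RInt_continuous _ _ _ (fun s _ => Hc (S n) s))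
              (ex_RInt_continuous _ _ _ (fun s _ => Hc n s))).
    match type of E with ?a = ?b => change b with
      (RInt (fun s => f s (picard_iter f (S n) s)) 0 t - RInt (fun s => f s (picard_iter f n s)) 0 t) in E end.
    rewrite <- E. clear E.
    (* Integrating [L * (K (/2) ^ n exp (2 L s))] divides by [2 L], which is where the halving comes
       from. *)
    set (A := K * (/2) ^ n / 2).
    assert (HA : 0 <= A).
    { unfold A. assert (0 < (/2) ^ n) by (apply pow_lt; lra).
      assert (0 <= K * (/2) ^ n) by (apply Rmult_le_pos; lra). lra. }
    apply Rle_trans with (A * exp (2 * L * t) - A * exp (2 * L * 0)).
    + apply (Rabs_RInt_le_increment _ (fun s => A * exp (2 * L * s))
              (fun s => A * (2 * L * exp (2 * L * s)))).
      * lra.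
      * intros s _. apply (continuous_minus (fun s => f s (picard_iter f (S n) s))
              (fun s => f s (picard_iter f n s))); apply Hc.
      * intros s _. auto_derive; [easy|ring].
      * intros s _. apply (ex_derive_continuous (fun s => A * (2 * L * exp (2 * L * s)))). auto_derive; easy.
      * intros s Hs.
        apply Rle_trans with (L * Rabs (picard_iter f (S n) s - picard_iter f n s)).
        -- apply HL. lra.
        -- replace (A * (2 * L * exp (2 * L * s)))
             with (L * (K * (/2) ^ n * exp (2 * L * s))) by (unfold A; field).
           apply Rmult_le_compat_l; [lra|]. apply IH. lra.
    + generalize (exp_pos (2 * L * 0)). intros He. simpl pow.
      replace (K * (/2 * (/2) ^ n)) with A by (unfold A; field).
      assert (0 <= A * exp (2 * L * 0)) by (apply Rmult_le_pos; lra). lra. }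
exists (K * exp (2 * L * T)). intros n t Ht.
rewrite <- (picard_iter_Rmax f (S n)), <- (picard_iter_Rmax f n).
assert (Ht' : 0 <= Rmax 0 t <= T).
{ split; [apply Rmax_l|now apply Rmax_lub]. }
apply Rle_trans with (1 := B n _ Ht').
replace (K * exp (2 * L * T) * (/2) ^ n) with (K * (/2) ^ n * exp (2 * L * T)) by ring.
apply Rmult_le_compat_l.
- apply Rmult_le_pos; [exact HK|]. apply pow_le; lra.
- destruct (Rle_lt_or_eq_dec _ _ (proj2 Ht')) as [H| H].
  + left. apply exp_increasing, Rmult_lt_compat_l; lra.
  + rewrite H. lra.
Qed.

(** The Lipschitz bound is global in the state and local in time. Hence the iterates converge on
    every [[0, T]] and the solution cannot blow up. *)
Theorem picard_global (f : R -> R -> R)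
  (Hf : forall p : R * R, continuous (fun q : R * R => f (fst q) (snd q)) p)
  (HL : forall T, exists L, forall s x y, 0 <= s <= T ->
     Rabs (f s x - f s y) <= L * Rabs (x - y)) :
  exists u : R -> R, (forall t, continuous u t) /\ u 0 = 0 /\
    forall t, 0 < t -> is_derive u t (f t (u t)).
Proof.
set (u := fun t => real (Lim_seq (fun n => picard_iter f n t))).
assert (HB : forall T, 0 <= T -> exists C L, 0 < L /\ 0 <= C /\
  (forall s x y, 0 <= s <= T -> Rabs (f s x - f s y) <= L * Rabs (x - y)) /\
  forall t, t <= T ->
    is_lim_seq (fun n => picard_iter f n t) (u t) /\
    forall n, Rabs (u t - picard_iter f n t) <= C * (/2) ^ n).
{ intros T HT. destruct (HL T) as [L HLT].
  assert (HLT' : forall s x y, 0 <= s <= T ->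
     Rabs (f s x - f s y) <= (Rabs L + 1) * Rabs (x - y)).
  { intros s x y Hs. apply Rle_trans with (1 := HLT s x y Hs).
    apply Rmult_le_compat_r; [apply Rabs_pos|]. generalize (Rle_abs L). lra. }
  assert (P : 0 < Rabs L + 1) by (generalize (Rabs_pos L); lra).
  destruct (picard_iter_step f Hf T _ HLT' P HT) as [C HC].
  exists (2 * C), (Rabs L + 1). repeat split; auto.
  - generalize (HC 0%nat T (Rle_refl T)). intros A.
    generalize (Rabs_pos (picard_iter f 1 T - picard_iter f 0 T)). rewrite pow_O in A. lra.
  - apply (geometric_cauchy _ C). intros n. now apply HC.
  - apply (geometric_cauchy _ C). intros n. now apply HC. }
assert (small : forall C eps, 0 < eps -> exists n, C * (/2) ^ n < eps).
{ intros C eps He.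
  assert (L0 : is_lim_seq (fun n => C * (/2) ^ n) 0).
  { replace (Finite 0) with (Rbar_mult C 0) by (simpl; f_equal; ring).
    apply is_lim_seq_scal_l, is_lim_seq_geom. rewrite Rabs_right; lra. }
  apply is_lim_seq_spec in L0. destruct (L0 (mkposreal eps He)) as [N HN].
  exists N. specialize (HN N (Nat.le_refl N)). simpl in HN.
  rewrite Rminus_0_r in HN. apply Rabs_lt_between in HN. lra. }
assert (uc : forall t, continuous u t).
{ intros t. apply continuous_eps. intros eps He.
  assert (T0 : 0 <= Rabs t + 1) by (generalize (Rabs_pos t); lra).
  destruct (HB _ T0) as [C [L [_ [_ [_ HC]]]]].
  destruct (small C (eps / 3)) as [n Hn]; [lra|].
  destruct (eps_continuous _ _ (picard_iter_continuous f Hf n t) (eps / 3)) as [d [Hd Hy]]; [lra|].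
  exists (Rmin d 1). split; [apply Rmin_pos; lra|]. intros y Hyd.
  assert (Hy1 : Rabs (y - t) < d) by (apply Rlt_le_trans with (1 := Hyd), Rmin_l).
  assert (Hy2 : Rabs (y - t) < 1) by (apply Rlt_le_trans with (1 := Hyd), Rmin_r).
  specialize (Hy y Hy1). apply Rabs_lt_between in Hy2.
  generalize (Rle_abs t); intros Ht.
  assert (A := proj2 (HC t ltac:(lra)) n). assert (B := proj2 (HC y ltac:(lra)) n).
  apply Rabs_le_between in A. apply Rabs_le_between in B.
  apply Rabs_lt_between in Hy. apply Rabs_lt_between. lra. }
assert (fc : forall s, continuous (fun s => f s (u s)) s).
{ intros s. apply (continuous_comp_2 (fun s => s) u f);
    [apply continuous_id|apply uc|apply Hf]. }
(* Both [u] and the integral of [f s (u s)] lie within a multiple of [(/2) ^ n] of the iterate of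
   index [n + 1], so they agree. *)
assert (ueq : forall t, 0 <= t -> u t = RInt (fun s => f s (u s)) 0 t).
{ intros t Ht. destruct (HB t Ht) as [C [L [HL0 [HC0 [HLt HC]]]]].
  apply cond_eq. intros eps He.
  destruct (small ((t * L + 1) * C) eps He) as [n Hn].
  assert (A := proj2 (HC t (Rle_refl t)) (S n)).
  assert (Hp : 0 < (/2) ^ n) by (apply pow_lt; lra).
  assert (Hc : forall s, continuous (fun s => f s (picard_iter f n s)) s).
  { intros s. apply (continuous_comp_2 (fun s => s) (picard_iter f n) f);
      [apply continuous_id|now apply picard_iter_continuous|apply Hf]. }
  assert (B : Rabs (RInt (fun s => f s (picard_iter f n s) - f s (u s)) 0 t)
              <= (t - 0) * (L * (C * (/2) ^ n))).
  { apply abs_RInt_le_const; [exact Ht| |].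
    - apply (ex_RInt_continuous (fun s => f s (picard_iter f n s) - f s (u s))).
      intros s _. apply (continuous_minus (fun s => f s (picard_iter f n s)) (fun s => f s (u s)));
      [apply Hc|apply fc].
    - intros s Hs. apply Rle_trans with (1 := HLt s _ _ Hs).
      apply Rmult_le_compat_l; [lra|]. rewrite Rabs_minus_sym. apply HC, Hs. }
  assert (E := RInt_minus (fun s => f s (picard_iter f n s)) (fun s => f s (u s)) 0 t
              (ex_RInt_continuous _ _ _ (fun s _ => Hc s))
              (ex_RInt_continuous _ _ _ (fun s _ => fc s))).
  match type of E with _ = ?b => change b with
      (RInt (fun s => f s (picard_iter f n s)) 0 t - RInt (fun s => f s (u s)) 0 t) in E end.
  match type of E with ?a = _ => change a with
      (RInt (fun s => f s (picard_iter f n s) - f s (u s)) 0 t) in E end.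
  rewrite E in B. simpl picard_iter in A. rewrite Rmax_right in A by lra.
  replace (u t - RInt (fun s => f s (u s)) 0 t)
    with ((u t - RInt (fun s => f s (picard_iter f n s)) 0 t)
          + (RInt (fun s => f s (picard_iter f n s)) 0 t - RInt (fun s => f s (u s)) 0 t)) by ring.
  apply Rle_lt_trans with (1 := Rabs_triang _ _).
  apply Rle_lt_trans with (2 := Hn).
  assert (C * (/2) ^ S n <= C * (/2) ^ n).
  { apply Rmult_le_compat_l; [exact HC0|]. simpl. lra. }
  lra. }
exists u. split; [|split].
- exact uc.
- rewrite ueq by lra. apply (RInt_point 0 (fun s => f s (u s))).
- intros t Ht. apply is_derive_ext_loc with (fun t => RInt (fun s => f s (u s)) 0 t).
  + apply (locally_gt _ 0 t Ht). intros y Hy. symmetry. apply ueq. lra.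
  + apply (is_derive_RInt (fun s => f s (u s)) _ 0 t); [|apply fc].
    apply filter_forall. intros z. apply (RInt_correct (fun s => f s (u s))).
    apply (ex_RInt_continuous (fun s => f s (u s))). intros; apply fc.
Qed.

(** * Powers *)

Lemma pw_pos (x y : R) : 0 < x -> pw x y = Rpower x y.
Proof. intros H. unfold pw. destruct (Rle_dec x 0); [lra|reflexivity]. Qed.

Lemma pw_nonpos (x y : R) : x <= 0 -> pw x y = 0.
Proof. intros H. unfold pw. destruct (Rle_dec x 0); [reflexivity|lra]. Qed.

Lemma pw_gt_0 (x y : R) : 0 < x -> 0 < pw x y.
Proof. intros H. rewrite pw_pos by exact H. apply exp_pos. Qed.

Lemma is_derive_pw (x y : R) : 0 < x -> is_derive (fun x => pw x y) x (y * pw x y / x).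
Proof.
intros H. apply is_derive_ext_loc with (fun x => Rpower x y).
- apply (locally_gt _ 0 x H). intros z Hz. symmetry. now apply pw_pos.
- replace (y * pw x y / x) with (y * Rpower x (y - 1)).
  + apply is_derive_Reals, derivable_pt_lim_power, H.
  + rewrite pw_pos by exact H. unfold Rminus.
    rewrite Rpower_plus, Rpower_Ropp, Rpower_1 by exact H. field. lra.
Qed.

Lemma continuous_pw (x y : R) : 0 < y -> continuous (fun x => pw x y) x.
Proof.
intros Hy. destruct (Rtotal_order x 0) as [H|[H|H]].
- apply continuous_ext_loc with (fun _ => 0); [|apply continuous_const].
  apply (locally_lt _ 0 x H). intros z Hz. symmetry. apply pw_nonpos. lra.
- subst x. apply continuous_eps. intros eps He. exists (Rpower eps (/ y)).
  split; [apply exp_pos|]. intros z Hz. rewrite Rminus_0_r in Hz.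
  rewrite (pw_nonpos 0) by lra. rewrite Rminus_0_r.
  destruct (Rle_dec z 0) as [H|H].
  + rewrite pw_nonpos by exact H. now rewrite Rabs_R0.
  + rewrite pw_pos by lra. rewrite Rabs_right by (left; apply exp_pos).
    replace eps with (Rpower (Rpower eps (/ y)) y).
    * apply Rlt_Rpower_l; [exact Hy|]. split; [lra|].
      now apply Rle_lt_trans with (1 := Rle_abs z).
    * rewrite Rpower_mult, Rinv_l, Rpower_1; lra.
- eapply is_derive_continuous, is_derive_pw, H.
Qed.

(** * The phase function *)

Section Phase.
Variables b c : R.
Hypothesis hb : 1 < b.

(** With [q = 1 + phase_decay * v], the gain [4 (b - 1) s ^ 2 / v * (1 - 1 / q ^ 2)] has to dominate
    the drift [2 c b s * (sqrt 2 s / q)]. It does so as soon as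
    [sqrt 2 |c| b = 2 (b - 1) phase_decay], and [sqrt 2 s / q] is then a subsolution. *)
Definition phase_decay := Rabs c * b / (sqrt 2 * (b - 1)).

Let s v := pw v (b - 1).
(** [Rmax 0 v] keeps [q >= 1] everywhere, so that [m], the square of the subsolution, has no pole at
    negative [v]. *)
Let q v := 1 + phase_decay * Rmax 0 v.
Let m v := 2 * s v ^ 2 / q v ^ 2.

Lemma phase_decay_nonneg : 0 <= phase_decay.
Proof.
unfold phase_decay. assert (0 < sqrt 2) by (apply sqrt_lt_R0; lra).
apply Rdiv_le_0_compat.
- apply Rmult_le_pos; [apply Rabs_pos|lra].
- apply Rmult_lt_0_compat; lra.
Qed.

Lemma phase_decay_eq : sqrt 2 * Rabs c * b = 2 * (b - 1) * phase_decay.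
Proof.
unfold phase_decay. assert (H : 0 < sqrt 2) by (apply sqrt_lt_R0; lra).
assert (E : sqrt 2 * sqrt 2 = 2) by (apply sqrt_sqrt; lra).
rewrite <- E at 2. field. lra.
Qed.

Let s_cont v : continuous s v.
Proof. apply continuous_pw. lra. Qed.

Let s_pos v : 0 < v -> 0 < s v.
Proof. apply pw_gt_0. Qed.

Let s_nonneg v : 0 <= s v.
Proof.
destruct (Rle_dec v 0) as [H|H].
- unfold s. rewrite pw_nonpos by exact H. lra.
- left. apply s_pos. lra.
Qed.

Let s_derive v : 0 < v -> is_derive s v ((b - 1) * s v / v).
Proof. apply is_derive_pw. Qed.

Let q_ge_1 v : 1 <= q v.
Proof.
unfold q. assert (0 <= phase_decay * Rmax 0 v); [|lra].
apply Rmult_le_pos; [apply phase_decay_nonneg|apply Rmax_l].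
Qed.

Let q_cont v : continuous q v.
Proof.
apply (continuous_plus (fun _ => 1) (fun v => phase_decay * Rmax 0 v)); [apply continuous_const|].
apply (continuous_mult (fun _ => phase_decay) (fun v => Rmax 0 v)); [apply continuous_const|].
apply continuous_Rmax_const.
Qed.

Let sqr_cont (f : R -> R) v : continuous f v -> continuous (fun v => 2 * f v ^ 2) v.
Proof.
intros H. apply (continuous_comp f (fun y => 2 * y ^ 2)); [exact H|].
apply (ex_derive_continuous (fun y => 2 * y ^ 2)). auto_derive. easy.
Qed.

Let m_cont v : continuous m v.
Proof.
apply (continuous_mult (fun v => 2 * s v ^ 2) (fun v => / q v ^ 2)); [now apply sqr_cont|].
apply (continuous_comp q (fun y => / y ^ 2)); [apply q_cont|].
apply (ex_derive_continuous (fun y => / y ^ 2)). auto_derive.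
generalize (q_ge_1 v). intros H E. nra.
Qed.

Let sqrt_m v : sqrt (m v) = sqrt 2 * s v / q v.
Proof.
generalize (q_ge_1 v) (s_nonneg v). intros Hq Hs.
assert (H2 : 0 < sqrt 2) by (apply sqrt_lt_R0; lra).
rewrite <- (sqrt_square (sqrt 2 * s v / q v)).
- f_equal. unfold m. rewrite <- (sqrt_sqrt 2) at 1 by lra. field. lra.
- apply Rdiv_le_0_compat; [apply Rmult_le_pos; lra|lra].
Qed.

(** The equation for [p ^ 2] contains [4 s s'], of order [v ^ (2 b - 3)], which is unbounded at [0]
    when [b < 3/2]. Passing to [p ^ 2 - 2 s ^ 2] removes that term and leaves a continuous
    right-hand side. *)
Let rhs v x := - 2 * c * b * s v * sqrt (Rmax (x + 2 * s v ^ 2) (m v)).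

Let rhs_cont (p : R * R) : continuous (fun q : R * R => rhs (fst q) (snd q)) p.
Proof.
assert (C1 : continuous (fun q : R * R => s (fst q)) p).
{ apply (continuous_comp fst s); [apply continuous_fst|apply s_cont]. }
apply (continuous_mult (fun q : R * R => - 2 * c * b * s (fst q))
         (fun q : R * R => sqrt (Rmax (snd q + 2 * s (fst q) ^ 2) (m (fst q))))).
- apply (continuous_mult (fun _ : R * R => - 2 * c * b) (fun q : R * R => s (fst q)));
    [apply continuous_const|exact C1].
- apply (continuous_comp (fun q : R * R => Rmax (snd q + 2 * s (fst q) ^ 2) (m (fst q))) sqrt);
    [|apply continuous_sqrt].
  apply continuous_ext with (fun q : R * R => m (fst q) + Rmax 0 (snd q + 2 * s (fst q) ^ 2 - m (fst q))).
  + intros z. unfold Rmax. repeat destruct Rle_dec; lra.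
  + assert (C2 : continuous (fun q : R * R => m (fst q)) p).
    { apply (continuous_comp fst m); [apply continuous_fst|apply m_cont]. }
    apply (continuous_plus (fun q : R * R => m (fst q))
      (fun q : R * R => Rmax 0 (snd q + 2 * s (fst q) ^ 2 - m (fst q)))); [exact C2|].
    apply (continuous_comp (fun q : R * R => snd q + 2 * s (fst q) ^ 2 - m (fst q)) (fun y => Rmax 0 y));
      [|apply continuous_Rmax_const].
    apply (continuous_minus (fun q : R * R => snd q + 2 * s (fst q) ^ 2) (fun q : R * R => m (fst q))); [|exact C2].
    apply (continuous_plus (fun q : R * R => snd q) (fun q : R * R => 2 * s (fst q) ^ 2));
      [apply continuous_snd|].
    apply (continuous_comp fst (fun v => 2 * s v ^ 2)); [apply continuous_fst|].
    now apply sqr_cont.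
Qed.

(** Above the floor [m] the square root has slope of order [q / s], and the factor [s] in front
    cancels the singular part. A multiple of [q v] remains, bounded on [[0, T]]. *)
Let rhs_lipschitz T : exists L, forall v x y, 0 <= v <= T ->
  Rabs (rhs v x - rhs v y) <= L * Rabs (x - y).
Proof.
exists (Rabs c * b * (1 + phase_decay * T)). intros v x y Hv.
(* At [v = 0] the floor is zero and gives no control of the square root, but there [s 0 = 0] makes
   [rhs] vanish. *)
destruct (Rle_lt_or_eq_dec 0 v (proj1 Hv)) as [Hp|<-].
2:{ unfold rhs. replace (s 0) with 0 by (symmetry; apply pw_nonpos; lra).
    rewrite !Rmult_0_r, !Rmult_0_l, Rminus_diag, Rabs_R0.
    apply Rmult_le_pos; [|apply Rabs_pos].
    apply Rmult_le_pos; [apply Rmult_le_pos; [apply Rabs_pos|lra]|].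
    generalize (Rmult_le_pos _ _ phase_decay_nonneg (Rle_trans _ _ _ (proj1 Hv) (proj2 Hv))). lra. }
unfold rhs.
set (X := Rmax (x + 2 * s v ^ 2) (m v)). set (Y := Rmax (y + 2 * s v ^ 2) (m v)).
assert (H2 : 1 < sqrt 2).
{ rewrite <- sqrt_1. apply sqrt_lt_1; lra. }
generalize (q_ge_1 v) (s_pos v Hp). intros Hq Hs.
assert (HX : sqrt 2 * s v / q v <= sqrt X).
{ rewrite <- sqrt_m. apply sqrt_le_1_alt, Rmax_r. }
assert (HY : sqrt 2 * s v / q v <= sqrt Y).
{ rewrite <- sqrt_m. apply sqrt_le_1_alt, Rmax_r. }
assert (m0 : 0 <= m v).
{ unfold m. apply Rdiv_le_0_compat; nra. }
assert (EX : sqrt X * sqrt X = X).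
{ apply sqrt_sqrt. apply Rle_trans with (1 := m0), Rmax_r. }
assert (EY : sqrt Y * sqrt Y = Y).
{ apply sqrt_sqrt. apply Rle_trans with (1 := m0), Rmax_r. }
assert (XY : Rabs (X - Y) <= Rabs (x - y)).
{ unfold X, Y, Rmax. repeat destruct Rle_dec; unfold Rabs; repeat destruct Rcase_abs; lra. }
assert (Hsq : s v / q v <= sqrt 2 * s v / q v).
{ unfold Rdiv. apply Rmult_le_compat_r; [left; apply Rinv_0_lt_compat; lra|nra]. }
assert (K : 2 * (s v / q v) * Rabs (sqrt X - sqrt Y) <= Rabs (x - y)).
{ apply Rle_trans with (2 := XY).
  replace (X - Y) with ((sqrt X + sqrt Y) * (sqrt X - sqrt Y)) by lra.
  rewrite Rabs_mult. apply Rmult_le_compat_r; [apply Rabs_pos|].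
  rewrite Rabs_right; [lra|].
  generalize (sqrt_pos X) (sqrt_pos Y); lra. }
replace (- 2 * c * b * s v * sqrt X - - 2 * c * b * s v * sqrt Y)
  with (- c * b * q v * (2 * (s v / q v) * (sqrt X - sqrt Y))) by (field; lra).
rewrite Rabs_mult. rewrite (Rabs_mult (2 * _)), (Rabs_right (2 * (s v / q v))).
2:{ apply Rle_ge, Rmult_le_pos; [lra|]. apply Rdiv_le_0_compat; lra. }
apply Rmult_le_compat; [apply Rabs_pos| | |exact K].
- apply Rmult_le_pos; [|apply Rabs_pos]. apply Rmult_le_pos; [lra|]. apply Rdiv_le_0_compat; lra.
- rewrite !Rabs_mult, Rabs_Ropp, (Rabs_right b), (Rabs_right (q v)) by lra.
  apply Rmult_le_compat_l; [apply Rmult_le_pos; [apply Rabs_pos|lra]|].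
  unfold q. rewrite Rmax_right by lra. apply Rplus_le_compat_l.
  apply Rmult_le_compat_l; [apply phase_decay_nonneg|lra].
Qed.

(* Picard's theorem is applied to the energy [p ^ 2 - 2 s ^ 2], whose equation is Lipschitz
   uniformly up to [v = 0] once [p ^ 2] is truncated below by the subsolution [m]. *)
Lemma phase_function_exists : exists p : R -> R,
  (forall v, continuous p v) /\
  (forall v, 0 < v -> is_derive p v (2 * (b - 1) * pw v (b - 1) ^ 2 / (v * p v) - c * b * pw v (b - 1))) /\
  (forall v, 0 < v -> sqrt 2 * pw v (b - 1) / (1 + phase_decay * v) <= p v) /\
  (forall v, 0 < v -> p v <= pw v (b - 1) * (sqrt 2 + b * Rmax 0 (- c) * v)).
Proof.
destruct (picard_global rhs rhs_cont rhs_lipschitz) as [G [Gc [G0 Gd]]].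
set (F := fun v => G v + 2 * s v ^ 2).
assert (H2 : 1 < sqrt 2).
{ rewrite <- sqrt_1. apply sqrt_lt_1; lra. }
assert (E2 : sqrt 2 * sqrt 2 = 2) by (apply sqrt_sqrt; lra).
assert (Fc : forall v, continuous F v).
{ intros v. apply (continuous_plus G (fun v => 2 * s v ^ 2)); [apply Gc|now apply sqr_cont]. }
assert (s0 : s 0 = 0) by (apply pw_nonpos; lra).
assert (Fd : forall v, 0 < v ->
  is_derive F v (4 * (b - 1) * s v ^ 2 / v - 2 * c * b * s v * sqrt (Rmax (F v) (m v)))).
{ intros v Hv. unfold F.
  replace (4 * (b - 1) * s v ^ 2 / v - 2 * c * b * s v * sqrt (Rmax (G v + 2 * s v ^ 2) (m v)))
    with (rhs v (G v) + ((b - 1) * s v / v) * (2 * (2 * s v ^ 1))) by (unfold rhs; field; lra).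
  apply (is_derive_plus G (fun v => 2 * s v ^ 2)); [now apply Gd|].
  apply (is_derive_comp (fun y => 2 * y ^ 2) s); [|now apply s_derive].
  auto_derive; [easy|]. simpl; ring. }
(* Where [F < m] the truncated root equals [sqrt (m v)], so the subsolution inequality for [m]
   applies verbatim. Once [m <= F] is known the truncation is inactive and [sqrt F] solves the true
   phase equation. *)
assert (lower : forall v, 0 < v -> m v <= F v).
{ intros v Hv. apply Rminus_le_0. apply (barrier (fun v => F v - m v) 0 v); [lra| | | |].
  - unfold F, m. rewrite G0, s0. unfold Rdiv. lra.
  - intros x _. apply (continuous_minus F m); [apply Fc|apply m_cont].
  - intros x Hx Hneg.
    assert (md : is_derive m x (4 * (b - 1) * s x ^ 2 / x / q x ^ 2 - 4 * s x ^ 2 * phase_decay / q x ^ 3)).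
    { apply is_derive_ext_loc with (fun v => 2 * s v ^ 2 / (1 + phase_decay * v) ^ 2).
      - apply (locally_gt _ 0 x (proj1 Hx)). intros z Hz.
        unfold m, q. now rewrite Rmax_right by lra.
      - generalize (q_ge_1 x). unfold q. rewrite Rmax_right by lra. intros Hq.
        generalize (s_derive x (proj1 Hx)). intros Hs. auto_derive.
        + split; [now exists ((b - 1) * s x / x)|]. split; [|easy].
          intros E. apply (pow_nonzero (1 + phase_decay * x) 2); [lra|]. simpl in *; lra.
        + match goal with |- context [Derive ?h x] =>
            replace (Derive h x) with ((b - 1) * s x / x) by (symmetry; exact (is_derive_unique s x _ Hs)) end. field. lra. }
    exists ((4 * (b - 1) * s x ^ 2 / x - 2 * c * b * s x * sqrt (Rmax (F x) (m x)))
      - (4 * (b - 1) * s x ^ 2 / x / q x ^ 2 - 4 * s x ^ 2 * phase_decay / q x ^ 3)).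
    split. { apply (is_derive_minus F m); [now apply Fd|exact md]. }
    rewrite Rmax_right by lra. rewrite sqrt_m.
    assert (Eq : q x = 1 + phase_decay * x) by (unfold q; now rewrite Rmax_right by lra).
    generalize (q_ge_1 x) phase_decay_nonneg phase_decay_eq. intros Hq HB HE.
    assert (Hc : c * b * sqrt 2 <= 2 * (b - 1) * phase_decay).
    { rewrite <- HE. generalize (Rle_abs c). intros.
      replace (c * b * sqrt 2) with (c * (b * sqrt 2)) by ring.
      replace (sqrt 2 * Rabs c * b) with (Rabs c * (b * sqrt 2)) by ring.
      apply Rmult_le_compat_r; nra. }
    (* This is the surplus left in the subsolution inequality after the drift is replaced by its
       bound [2 (b - 1) phase_decay]. *)
    apply Rle_trans with (4 * phase_decay * s x ^ 2 * ((b - 1) / q x ^ 2 + 1 / q x ^ 3)).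
    { apply Rmult_le_pos; [apply Rmult_le_pos; nra|].
      apply Rplus_le_le_0_compat; apply Rdiv_le_0_compat; try lra; apply pow_lt; lra. }
    apply Rle_trans with
      (4 * (b - 1) * s x ^ 2 / x - 2 * s x ^ 2 / q x * (2 * (b - 1) * phase_decay)
       - (4 * (b - 1) * s x ^ 2 / x / q x ^ 2 - 4 * s x ^ 2 * phase_decay / q x ^ 3)).
    { right. rewrite Eq. rewrite Eq in Hq. field. lra. }
    apply Rplus_le_compat_r, Rplus_le_compat_l, Ropp_le_contravar.
    replace (2 * c * b * s x * (sqrt 2 * s x / q x)) with (2 * s x ^ 2 / q x * (c * b * sqrt 2)) by (field; lra).
    apply Rmult_le_compat_l; [|exact Hc]. apply Rdiv_le_0_compat; nra.
  - intros x Hx. apply (ex_derive_minus F m); [eexists; apply Fd; lra|].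
    unfold m. apply ex_derive_ext_loc with (fun v => 2 * s v ^ 2 / (1 + phase_decay * v) ^ 2).
    + apply (locally_gt _ 0 x (proj1 Hx)). intros z Hz.
        unfold q. now rewrite Rmax_right by lra.
    + generalize (q_ge_1 x). unfold q. rewrite Rmax_right by lra. intros Hq.
      auto_derive. split; [exists ((b - 1) * s x / x); apply s_derive; lra|]. split; [|easy].
      intros E. apply (pow_nonzero (1 + phase_decay * x) 2); [lra|]. simpl in *; lra. }
assert (low : forall v, 0 < v -> sqrt 2 * s v / q v <= sqrt (F v)).
{ intros v Hv. rewrite <- sqrt_m. apply sqrt_le_1_alt. now apply lower. }
assert (ppos : forall v, 0 < v -> 0 < sqrt (F v)).
{ intros v Hv. apply Rlt_le_trans with (2 := low v Hv).
  generalize (q_ge_1 v) (s_pos v Hv). intros. apply Rdiv_lt_0_compat; [nra|lra]. }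
assert (pd : forall v, 0 < v -> is_derive (fun v => sqrt (F v)) v
  (2 * (b - 1) * s v ^ 2 / (v * sqrt (F v)) - c * b * s v)).
{ intros v Hv. generalize (ppos v Hv); intros Hp.
  assert (HF : 0 < F v).
  { destruct (Rlt_le_dec 0 (F v)) as [H|H]; [exact H|]. rewrite sqrt_neg_0 in Hp; lra. }
  replace (2 * (b - 1) * s v ^ 2 / (v * sqrt (F v)) - c * b * s v)
    with ((4 * (b - 1) * s v ^ 2 / v - 2 * c * b * s v * sqrt (Rmax (F v) (m v))) / (2 * sqrt (F v))).
  - apply is_derive_sqrt; [now apply Fd|exact HF].
  - rewrite Rmax_left by (now apply lower). field. lra. }
assert (pc : forall v, continuous (fun v => sqrt (F v)) v).
{ intros v. apply continuous_sqrt_comp, Fc. }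
exists (fun v => sqrt (F v)). split; [exact pc|]. split; [exact pd|]. split.
- intros v Hv. generalize (low v Hv). unfold q. now rewrite Rmax_right by lra.
- intros v Hv. fold (s v). apply Rminus_le_0.
  set (k := Rmax 0 (- c)).
  assert (k0 : 0 <= k) by apply Rmax_l. assert (kc : - c <= k) by apply Rmax_r.
  assert (sd : forall x, 0 < x -> is_derive (fun v => s v * (sqrt 2 + b * k * v)) x
     ((b - 1) * s x / x * (sqrt 2 + b * k * x) + s x * (b * k))).
  { intros x Hx. generalize (s_derive x Hx). intros Hs. auto_derive.
    - now exists ((b - 1) * s x / x).
    - match goal with |- context [Derive ?h x] =>
            replace (Derive h x) with ((b - 1) * s x / x) by (symmetry; exact (is_derive_unique s x _ Hs)) end. ring. }
  (* Where [p] exceeds the barrier it exceeds [sqrt 2 s], so the singular term of [p'] is at most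
     [sqrt 2 (b - 1) s / v], a term of the barrier's own derivative. The drift is at most [b k s],
     since [- c <= k]. *)
  apply (barrier (fun v => s v * (sqrt 2 + b * k * v) - sqrt (F v)) 0 v); [lra| | | |].
  + unfold F. rewrite G0, s0. replace (0 + 2 * 0 ^ 2) with 0 by ring. rewrite sqrt_0. lra.
  + intros x _. apply (continuous_minus (fun v => s v * (sqrt 2 + b * k * v)) (fun v => sqrt (F v))); [|apply pc].
    apply (continuous_mult s (fun v => sqrt 2 + b * k * v)); [apply s_cont|].
    apply (ex_derive_continuous (fun v => sqrt 2 + b * k * v)). auto_derive. easy.
  + intros x Hx Hneg. eexists. split.
    { apply (is_derive_minus (fun v => s v * (sqrt 2 + b * k * v)) (fun v => sqrt (F v)));
        [apply sd; lra|apply pd; lra]. }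
    unfold minus, plus, opp; simpl.
    generalize (s_pos x (proj1 Hx)) (ppos x (proj1 Hx)). intros Hs Hp.
    assert (Hbk : 0 <= b * k * x) by (apply Rmult_le_pos; [apply Rmult_le_pos|]; lra).
    assert (Hp2 : sqrt 2 * s x <= sqrt (F x)) by nra.
    assert (A : 2 * (b - 1) * (s x * (s x * 1)) / (x * sqrt (F x)) <= (b - 1) * s x / x * sqrt 2).
    { apply Rmult_le_reg_r with (x * sqrt (F x)); [apply Rmult_lt_0_compat; lra|].
      replace (2 * (b - 1) * (s x * (s x * 1)) / (x * sqrt (F x)) * (x * sqrt (F x)))
        with ((b - 1) * s x * sqrt 2 * (sqrt 2 * s x)).
      - replace ((b - 1) * s x / x * sqrt 2 * (x * sqrt (F x))) with ((b - 1) * s x * sqrt 2 * sqrt (F x)) by (field; lra).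
        apply Rmult_le_compat_l; [|exact Hp2]. apply Rmult_le_pos; [|lra]. apply Rmult_le_pos; lra.
      - replace ((b - 1) * s x * sqrt 2 * (sqrt 2 * s x)) with ((b - 1) * s x * s x * (sqrt 2 * sqrt 2)) by ring.
        rewrite E2. field. lra. }
    assert (A1 : 0 <= (b - 1) * s x / x * (b * k * x)).
    { apply Rmult_le_pos; [|exact Hbk]. apply Rdiv_le_0_compat; [apply Rmult_le_pos|]; lra. }
    assert (A2 : 0 <= s x * b * (k + c)).
    { apply Rmult_le_pos; [apply Rmult_le_pos|]; lra. }
    simpl in A. unfold Rminus.
    replace ((b - 1) * s x / x * (sqrt 2 + b * k * x))
      with ((b - 1) * s x / x * sqrt 2 + (b - 1) * s x / x * (b * k * x)) by ring.
    lra.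
  + intros x Hx. apply (ex_derive_minus (fun v => s v * (sqrt 2 + b * k * v)) (fun v => sqrt (F v)));
      eexists; [apply sd; lra|apply pd; lra].
Qed.

End Phase.

(** * The increasing profile *)

Lemma pw_pw (x y z : R) : 0 < x -> pw (pw x y) z = pw x (y * z).
Proof.
intros H. rewrite !(pw_pos x) by exact H. rewrite pw_pos by apply exp_pos.
apply Rpower_mult.
Qed.

Lemma pw_1 (x : R) : 0 < x -> pw x 1 = x.
Proof. intros H. rewrite pw_pos by exact H. now apply Rpower_1. Qed.

Lemma pw_minus_1 (x y : R) : 0 < x -> pw x (y - 1) = pw x y / x.
Proof.
intros H. rewrite !pw_pos by exact H. unfold Rminus.
now rewrite Rpower_plus, Rpower_Ropp, Rpower_1 by exact H.
Qed.

Lemma beta_gt_1 (g : R) : 0 < g <= 1 -> 1 < beta g.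
Proof.
intros H. unfold beta. apply Rmult_lt_reg_r with (2 - g); [lra|].
unfold Rdiv. rewrite Rmult_assoc, Rinv_l by lra. lra.
Qed.

Lemma beta_mult (g : R) : 0 < g <= 1 -> g * beta g = 2 * (beta g - 1).
Proof. intros H. unfold beta. field. lra. Qed.

Lemma is_derive_locally_eq (f h : R -> R) (x y l : R) : x < y ->
  (forall z, x < z -> f z = h z) -> is_derive f y l -> is_derive h y l.
Proof.
intros Hxy E. apply is_derive_ext_loc.
now apply (locally_gt _ x).
Qed.

(** The mean value theorem for [Th], turned around, reads [V (x + h) - V x = P w * h] with [w]
    between the two values of [V]. Continuity of [V] and [P] then sends [P w] to [P (V x)]. *)
Lemma is_derive_inverse_flow (P Th V : R -> R) :
  (forall v, continuous P v) -> (forall v, 0 < P v) ->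
  (forall v, is_derive Th v (/ P v)) -> (forall x, Th (V x) = x) ->
  forall x, is_derive V x (P (V x)).
Proof.
intros Pc Pp Td TV.
assert (mvt : forall y z, y < z -> exists w, y < w < z /\ z - y = P w * (Th z - Th y)).
{ intros y z Hyz. destruct (mean_value Th (fun v => / P v) y z Hyz) as [w [Hw E]].
  - intros; apply Td.
  - intros w _. eapply is_derive_continuous, Td.
  - exists w. split; [exact Hw|]. rewrite E. generalize (Pp w). intros. field. lra. }
assert (inc : forall y z, y < z -> Th y < Th z).
{ intros y z Hyz. destruct (mvt y z Hyz) as [w [_ E]].
  generalize (Pp w). intros Hw. nra. }
assert (Vinc : forall x y, x < y -> V x < V y).
{ intros x y Hxy. destruct (Rlt_le_dec (V x) (V y)) as [H|H]; [exact H|].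
  destruct (Rle_lt_or_eq_dec _ _ H) as [H1|H1].
  - apply inc in H1. rewrite !TV in H1. lra.
  - assert (E := TV x). rewrite <- H1, TV in E. lra. }
assert (Vc : forall x, continuous V x).
{ intros x. apply continuous_eps. intros eps He.
  assert (H1 := inc (V x - eps) (V x) ltac:(lra)).
  assert (H2 := inc (V x) (V x + eps) ltac:(lra)). rewrite TV in H1, H2.
  exists (Rmin (x - Th (V x - eps)) (Th (V x + eps) - x)).
  split; [apply Rmin_pos; lra|]. intros y Hy.
  assert (Hy1 := Rlt_le_trans _ _ _ Hy (Rmin_l _ _)).
  assert (Hy2 := Rlt_le_trans _ _ _ Hy (Rmin_r _ _)).
  apply Rabs_lt_between in Hy1. apply Rabs_lt_between in Hy2.
  apply Rabs_lt_between.
  assert (A : forall u v, Th u < Th v -> u < v).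
  { intros u v Huv. destruct (Rlt_le_dec u v) as [H|H]; [exact H|].
    destruct (Rle_lt_or_eq_dec _ _ H) as [H3|H3]; [apply inc in H3; lra|subst; lra]. }
  assert (V x - eps < V y) by (apply A; rewrite TV; lra).
  assert (V y < V x + eps) by (apply A; rewrite TV; lra). lra. }
intros x. apply is_derive_Reals. intros eps He.
destruct (eps_continuous P (V x) (Pc (V x)) eps He) as [d [Hd HP]].
destruct (eps_continuous V x (Vc x) d Hd) as [d' [Hd' HV]].
exists (mkposreal d' Hd'). intros h Hh Hhd. simpl in Hhd.
specialize (HV (x + h)). replace (x + h - x) with h in HV by ring. specialize (HV Hhd).
assert (W : exists w, Rabs (w - V x) < d /\ V (x + h) - V x = P w * h).
{ apply Rabs_lt_between in HV.
  destruct (Rdichotomy h 0 Hh) as [H|H].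
  - destruct (mvt (V (x + h)) (V x)) as [w [Hw E]]; [apply Vinc; lra|].
    exists w. split; [apply Rabs_lt_between; lra|]. rewrite !TV in E. lra.
  - destruct (mvt (V x) (V (x + h))) as [w [Hw E]]; [apply Vinc; lra|].
    exists w. split; [apply Rabs_lt_between; lra|]. rewrite !TV in E.
    replace (x + h - x) with h in E by ring. exact E. }
destruct W as [w [Hw E]]. rewrite E.
replace (P w * h / h - P (V x)) with (P w - P (V x)) by (field; exact Hh).
now apply HP.
Qed.

(** * Limits at infinity and extremal zeros *)

Lemma filterlim_p_infty_eps (f : R -> R) (l : R) :
  (forall eps, 0 < eps -> exists M, forall x, M < x -> Rabs (f x - l) < eps) ->
  filterlim f (Rbar_locally p_infty) (locally l).
Proof.
intros H. apply filterlim_locally. intros eps.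
destruct (H eps (cond_pos eps)) as [M HM]. exists M. intros x Hx. exact (HM x Hx).
Qed.

Lemma eps_filterlim_p_infty (f : R -> R) (l : R) :
  filterlim f (Rbar_locally p_infty) (locally l) ->
  forall eps, 0 < eps -> exists M, forall x, M < x -> Rabs (f x - l) < eps.
Proof.
intros H eps He.
destruct (proj1 (filterlim_locally f l) H (mkposreal eps He)) as [M HM].
exists M. intros x Hx. exact (HM x Hx).
Qed.

(** A form of l'Hopital's rule. Beyond [M] the mean value theorem bounds [f x - L x] by
    [A + eps / 2 * x], and the constant [A] is absorbed once [x > 2 A / eps]. *)
Lemma average_of_derive_limit (f df : R -> R) (L : R) :
  (forall x, 0 < x -> is_derive f x (df x)) ->
  filterlim df (Rbar_locally p_infty) (locally L) ->
  filterlim (fun x => f x / x) (Rbar_locally p_infty) (locally L).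
Proof.
intros Hd HL. apply filterlim_p_infty_eps. intros eps He.
destruct (eps_filterlim_p_infty _ _ HL (eps / 2)) as [M0 HM0]; [lra|].
set (M := Rmax 0 M0 + 1).
assert (M_pos : 1 <= M) by (unfold M; generalize (Rmax_l 0 M0); lra).
assert (HM : forall x, M <= x -> Rabs (df x - L) < eps / 2).
{ intros x Hx. apply HM0. unfold M in Hx. generalize (Rmax_r 0 M0). lra. }
set (A := Rabs (f M - L * M)).
exists (Rmax M (2 * A / eps)). intros x Hx.
assert (H1 := Rle_lt_trans _ _ _ (Rmax_l _ _) Hx).
assert (H2 := Rle_lt_trans _ _ _ (Rmax_r _ _) Hx).
destruct (mean_value f df M x H1) as [z [Hz E]].
- intros; apply Hd; lra.
- intros y Hy. eapply is_derive_continuous, Hd; lra.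
- apply (Rmult_lt_compat_r eps) in H2; [|exact He].
  replace (2 * A / eps * eps) with (2 * A) in H2 by (field; lra).
  specialize (HM z ltac:(lra)).
  replace (f x / x - L) with ((f x - L * x) / x) by (field; lra).
  unfold Rdiv. rewrite Rabs_mult, Rabs_inv, (Rabs_right x) by lra.
  apply Rmult_lt_reg_r with x; [lra|]. rewrite Rmult_assoc, Rinv_l, Rmult_1_r by lra.
  replace (f x - L * x) with ((f M - L * M) + (df z - L) * (x - M)) by lra.
  apply Rle_lt_trans with (1 := Rabs_triang _ _). fold A.
  rewrite Rabs_mult, (Rabs_right (x - M)) by lra.
  assert (Rabs (df z - L) * (x - M) <= eps / 2 * x).
  { apply Rmult_le_compat; [apply Rabs_pos|lra|lra|lra]. }
  lra.
Qed.

(** The clause [f x0 <= L] later makes the prefactor of the exponential positive. *)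
Lemma bounded_monotone_limit (f : R -> R) (x0 M : R) :
  (forall x y, x0 <= x <= y -> f x <= f y) -> (forall x, x0 <= x -> f x <= M) ->
  exists L, f x0 <= L /\ filterlim f (Rbar_locally p_infty) (locally L).
Proof.
intros Hi Hb.
destruct (completeness (fun y => exists x, x0 <= x /\ y = f x)) as [L [HL1 HL2]].
- exists M. intros y [x [Hx ->]]. now apply Hb.
- exists (f x0), x0. split; [lra|reflexivity].
- exists L. split; [apply HL1; exists x0; split; [lra|reflexivity]|].
  apply filterlim_p_infty_eps. intros eps He.
  destruct (Classical_Prop.classic (exists x, x0 <= x /\ L - eps < f x)) as [[x [Hx Hf]]|H].
  + exists x. intros y Hy. assert (A := Hi x y ltac:(lra)).
    assert (f y <= L) by (apply HL1; exists y; split; [lra|reflexivity]).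
    apply Rabs_lt_between. lra.
  + exfalso. assert (A : L <= L - eps); [|lra].
    apply HL2. intros y [x [Hx ->]].
    destruct (Rle_lt_dec (f x) (L - eps)) as [H1|H1]; [exact H1|].
    exfalso. apply H. now exists x.
Qed.

Lemma last_zero (f : R -> R) (x0 x1 : R) : (forall x, continuous f x) ->
  (forall x, 0 <= f x) -> x0 < x1 -> f x0 = 0 -> 0 < f x1 ->
  exists l, x0 <= l < x1 /\ f l = 0 /\ forall x, l < x <= x1 -> 0 < f x.
Proof.
intros Hc Hp H01 H0 H1.
destruct (completeness (fun x => x <= x1 /\ f x = 0)) as [l [Hl1 Hl2]].
- exists x1. now intros y [Hy _].
- exists x0. split; [lra|exact H0].
- assert (A0 : x0 <= l) by (apply Hl1; split; [lra|exact H0]).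
  assert (A1 : l <= x1) by (apply Hl2; now intros y [Hy _]).
  assert (fl : f l = 0).
  { destruct (Rle_lt_or_eq_dec _ _ (Hp l)) as [H|H]; [exfalso|now symmetry].
    destruct (eps_continuous f l (Hc l) (f l) H) as [d [Hd Hy]].
    assert (A : l <= l - d / 2); [|lra]. apply Hl2. intros y [Hy1 Hy2].
    destruct (Rle_lt_dec y (l - d / 2)) as [Hyl|Hyl]; [exact Hyl|exfalso].
    assert (y <= l) by (apply Hl1; now split).
    specialize (Hy y). rewrite Hy2 in Hy.
    assert (Rabs (y - l) < d) by (apply Rabs_lt_between; lra).
    apply Hy in H3. apply Rabs_lt_between in H3. lra. }
  exists l. split; [|split; [exact fl|]].
  + split; [exact A0|]. destruct (Rle_lt_or_eq_dec _ _ A1) as [H|H]; [exact H|].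
    rewrite H in fl. lra.
  + intros x Hx. destruct (Rle_lt_or_eq_dec _ _ (Hp x)) as [H|H]; [exact H|exfalso].
    assert (x <= l) by (apply Hl1; split; [lra|now symmetry]). lra.
Qed.

Lemma first_zero (f : R -> R) (x0 x1 : R) : (forall x, continuous f x) ->
  (forall x, 0 <= f x) -> x0 < x1 -> 0 < f x0 -> f x1 = 0 ->
  exists r, x0 < r <= x1 /\ f r = 0 /\ forall x, x0 <= x < r -> 0 < f x.
Proof.
intros Hc Hp H01 H0 H1.
destruct (last_zero (fun x => f (- x)) (- x1) (- x0)) as [l [Hl [fl Hx]]].
- intros x. apply (continuous_comp Ropp f); [|apply Hc].
  apply (ex_derive_continuous Ropp). auto_derive. easy.
- intros; apply Hp.
- lra.
- now rewrite Ropp_involutive.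
- now rewrite Ropp_involutive.
- exists (- l). split; [lra|]. split; [exact fl|]. intros x Hxl.
  rewrite <- (Ropp_involutive x). apply Hx. lra.
Qed.

(** * The profile attached to a phase function *)

Section Profile.
Variables g c : R.
Hypothesis hg : 0 < g <= 1.

Let b := beta g.
Let a := sqrt 2 / b.
Let B := phase_decay b c.
Let k := Rmax 0 (- c).
Let s v := pw v (b - 1).

Variable p : R -> R.
Hypothesis p_cont : forall v, continuous p v.
Hypothesis p_derive : forall v, 0 < v ->
  is_derive p v (2 * (b - 1) * pw v (b - 1) ^ 2 / (v * p v) - c * b * pw v (b - 1)).
Hypothesis p_lower : forall v, 0 < v -> sqrt 2 * pw v (b - 1) / (1 + B * v) <= p v.
Hypothesis p_upper : forall v, 0 < v -> p v <= pw v (b - 1) * (sqrt 2 + b * k * v).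

Let b_gt_1 : 1 < b.
Proof. now apply beta_gt_1. Qed.

Let B_nonneg : 0 <= B.
Proof. now apply phase_decay_nonneg. Qed.

Let k_nonneg : 0 <= k.
Proof. apply Rmax_l. Qed.

Let sqrt2_gt_1 : 1 < sqrt 2.
Proof. rewrite <- sqrt_1. apply sqrt_lt_1; lra. Qed.

Let a_pos : 0 < a.
Proof. apply Rdiv_lt_0_compat; lra. Qed.

Let s_pos v : 0 < v -> 0 < s v.
Proof. apply pw_gt_0. Qed.

Let p_pos v : 0 < v -> 0 < p v.
Proof.
intros H. apply Rlt_le_trans with (2 := p_lower v H).
generalize (s_pos v H). unfold s. intros Hs.
apply Rdiv_lt_0_compat; [apply Rmult_lt_0_compat; lra|].
assert (0 <= B * v) by (apply Rmult_le_pos; lra). lra.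
Qed.

(** The barriers concern [v > 0] only; the value at [0] follows by squeezing and continuity. *)
Let p_0 : p 0 = 0.
Proof.
assert (C1 : continuous (fun v => pw v (b - 1) * (sqrt 2 + b * k * v)) 0).
{ apply (continuous_mult (fun v => pw v (b - 1)) (fun v => sqrt 2 + b * k * v)).
  - apply continuous_pw; lra.
  - apply (ex_derive_continuous (fun v => sqrt 2 + b * k * v)). auto_derive. easy. }
apply cond_eq. intros eps He. rewrite Rminus_0_r.
destruct (eps_continuous _ _ C1 (eps / 2)) as [d1 [Hd1 H1]]; [lra|].
destruct (eps_continuous _ _ (p_cont 0) (eps / 2)) as [d2 [Hd2 H2]]; [lra|].
set (v := Rmin d1 d2 / 2).
assert (Hv : 0 < v) by (unfold v; generalize (Rmin_pos _ _ Hd1 Hd2); lra).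
assert (Hv1 : v < d1) by (unfold v in *; generalize (Rmin_l d1 d2); lra).
assert (Hv2 : v < d2) by (unfold v in *; generalize (Rmin_r d1 d2); lra).
specialize (H1 v). specialize (H2 v). rewrite Rminus_0_r, Rabs_right in H1, H2 by lra.
specialize (H1 Hv1). specialize (H2 Hv2).
rewrite (pw_nonpos 0) in H1 by lra. rewrite Rmult_0_l, Rminus_0_r in H1.
apply Rabs_lt_between in H1. apply Rabs_lt_between in H2. apply Rabs_lt_between.
generalize (p_upper v Hv) (p_pos v Hv). lra.
Qed.

(** This is [v'] as a function of [v]. The value [a] for [v <= 0] extends it to a continuous
    positive function on the line, so that [v' = slope v] can be solved straight through the free
    boundary. The free boundary condition for the profile becomes continuity of [slope] at [0]. *)
Definition slope v := if Rle_dec v 0 then a else p v / (b * s v).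

Let slope_nonpos v : v <= 0 -> slope v = a.
Proof. intros H. unfold slope. destruct (Rle_dec v 0); [reflexivity|lra]. Qed.

Let slope_pos_eq v : 0 < v -> slope v = p v / (b * s v).
Proof. intros H. unfold slope. destruct (Rle_dec v 0); [lra|reflexivity]. Qed.

Let slope_lower v : 0 < v -> a / (1 + B * v) <= slope v.
Proof.
intros H. rewrite slope_pos_eq by exact H. generalize (s_pos v H) (p_lower v H). unfold s, a.
intros Hs Hp. assert (0 <= B * v) by (apply Rmult_le_pos; lra).
apply Rmult_le_reg_r with (b * pw v (b - 1)); [apply Rmult_lt_0_compat; lra|].
replace (p v / (b * pw v (b - 1)) * (b * pw v (b - 1))) with (p v) by (field; lra).
apply Rle_trans with (2 := Hp). right. field. lra.
Qed.

Let slope_upper v : 0 < v -> slope v <= a + k * v.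
Proof.
intros H. rewrite slope_pos_eq by exact H. generalize (s_pos v H) (p_upper v H). unfold s, a.
intros Hs Hp.
apply Rmult_le_reg_r with (b * pw v (b - 1)); [apply Rmult_lt_0_compat; lra|].
replace (p v / (b * pw v (b - 1)) * (b * pw v (b - 1))) with (p v) by (field; lra).
apply Rle_trans with (1 := Hp). right. field. lra.
Qed.

Let slope_pos v : 0 < slope v.
Proof.
destruct (Rle_dec v 0) as [H|H]; [now rewrite slope_nonpos|].
rewrite slope_pos_eq by lra. generalize (s_pos v ltac:(lra)) (p_pos v ltac:(lra)). intros.
apply Rdiv_lt_0_compat; [lra|apply Rmult_lt_0_compat; lra].
Qed.

Let slope_cont v : continuous slope v.
Proof.
destruct (Rtotal_order v 0) as [H|[H|H]].
- apply continuous_ext_loc with (fun _ => a); [|apply continuous_const].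
  apply (locally_lt _ 0 v H). intros z Hz. symmetry. apply slope_nonpos. lra.
- subst v. apply continuous_eps. intros eps He.
  (* On the right of [0] the two bounds differ from [a] by at most [a B v] and [k v]. The [+ 1]
     keeps the denominator positive when both constants vanish. *)
  exists (eps / (a * B + k + 1)).
  assert (aB : 0 <= a * B) by (apply Rmult_le_pos; lra).
  split; [apply Rdiv_lt_0_compat; lra|]. intros v Hv. rewrite Rminus_0_r in Hv.
  rewrite (slope_nonpos 0) by lra.
  destruct (Rle_dec v 0) as [H|H].
  + rewrite slope_nonpos by exact H. rewrite Rminus_diag, Rabs_R0. exact He.
  + rewrite Rabs_right in Hv by lra.
    apply (Rmult_lt_compat_r (a * B + k + 1)) in Hv; [|lra].
    replace (eps / (a * B + k + 1) * (a * B + k + 1)) with eps in Hv by (field; lra).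
    generalize (slope_lower v ltac:(lra)) (slope_upper v ltac:(lra)). intros H1 H2.
    assert (0 <= k * v) by (apply Rmult_le_pos; lra).
    assert (0 <= B * v) by (apply Rmult_le_pos; lra).
    assert (Hlow : a - a * B * v <= a / (1 + B * v)).
    { apply Rmult_le_reg_r with (1 + B * v); [lra|].
      replace (a / (1 + B * v) * (1 + B * v)) with a by (field; lra).
      assert (0 <= a * (B * v) ^ 2) by (apply Rmult_le_pos; [lra|apply pow2_ge_0]). lra. }
    apply Rabs_lt_between.
    assert (0 <= a * B * v) by (apply Rmult_le_pos; lra). lra.
- apply continuous_ext_loc with (fun v => p v / (b * s v)).
  + apply (locally_gt _ 0 v H). intros z Hz. symmetry. now apply slope_pos_eq.
  + apply (continuous_mult p (fun v => / (b * s v))); [apply p_cont|].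
    apply (continuous_Rinv_comp (fun v => b * s v)).
    * apply (continuous_mult (fun _ => b) s); [apply continuous_const|].
      apply continuous_pw. lra.
    * apply Rgt_not_eq, Rmult_lt_0_compat; [lra|now apply s_pos].
Qed.

Definition travel_time v := RInt (fun w => / slope w) 0 v.

Let travel_time_derive v : is_derive travel_time v (/ slope v).
Proof.
assert (C : forall w, continuous (fun w => / slope w) w).
{ intros w. apply continuous_Rinv_comp; [apply slope_cont|]. apply Rgt_not_eq, slope_pos. }
apply (is_derive_RInt (fun w => / slope w) _ 0 v); [|apply C].
apply filter_forall. intros z. apply (RInt_correct (fun w => / slope w)).
apply (ex_RInt_continuous (fun w => / slope w)). intros; apply C.
Qed.

Let travel_time_cont v : continuous travel_time v.
Proof. eapply is_derive_continuous, travel_time_derive. Qed.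

Let travel_time_0 : travel_time 0 = 0.
Proof. apply (RInt_point 0 (fun w => / slope w)). Qed.

Let travel_time_incr v w : v < w -> travel_time v < travel_time w.
Proof.
intros H. destruct (mean_value travel_time (fun v => / slope v) v w H) as [z [Hz E]].
- intros; apply travel_time_derive.
- intros; apply travel_time_cont.
- assert (0 < / slope z * (w - v)); [|lra].
  apply Rmult_lt_0_compat; [now apply Rinv_0_lt_compat|lra].
Qed.

Let travel_time_inj v w : travel_time v = travel_time w -> v = w.
Proof.
intros E. destruct (Rtotal_order v w) as [H|[H|H]]; [|exact H|];
  apply travel_time_incr in H; lra.
Qed.

Let travel_time_nonpos v : v <= 0 -> travel_time v = v / a.
Proof.
intros H. unfold travel_time. rewrite (RInt_ext _ (fun _ => / a)).
- rewrite (RInt_const 0 v (/ a)). unfold scal; simpl; unfold mult; simpl. field. lra.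
- intros w. rewrite Rmin_right, Rmax_left by lra. intros Hw. rewrite slope_nonpos; lra.
Qed.

(** From [slope v <= a + k v <= (a + k) (1 + v)]: the growth is at most linear, so reaching infinity
    takes infinite time. *)
Let travel_time_lower v : 0 <= v -> ln (1 + v) / (a + k) <= travel_time v.
Proof.
intros H. apply Rminus_le_0.
replace 0 with (travel_time 0 - ln (1 + 0) / (a + k)) at 1.
2:{ rewrite travel_time_0, Rplus_0_r, ln_1. field. lra. }
assert (D : forall x, 0 <= x -> is_derive (fun v => travel_time v - ln (1 + v) / (a + k)) x
   (/ slope x - / (1 + x) / (a + k))).
{ intros x Hx. apply (is_derive_minus travel_time (fun v => ln (1 + v) / (a + k)));
    [apply travel_time_derive|]. auto_derive; [lra|field; lra]. }
apply (nondecreasing_of_derive (fun v => travel_time v - ln (1 + v) / (a + k)) 0 v H).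
- intros x Hx. eexists; split; [apply D; lra|].
  apply -> Rminus_le_0.
  replace (/ (1 + x) / (a + k)) with (/ ((1 + x) * (a + k))) by (field; lra).
  apply Rinv_le_contravar; [apply slope_pos|].
  apply Rle_trans with (1 := slope_upper x (proj1 Hx)).
  assert (0 <= a * x) by (apply Rmult_le_pos; lra). nra.
- intros x Hx. eapply is_derive_continuous, D; lra.
Qed.

Lemma travel_time_surj x : exists v, travel_time v = x.
Proof.
(* Left of [0] the travel time is [v / a]; [v2] is the point where the logarithmic lower bound
   equals [Rmax 0 x]. *)
set (v1 := Rmin 0 (a * x)). set (v2 := exp ((a + k) * Rmax 0 x) - 1).
assert (H1 : travel_time v1 <= x).
{ rewrite travel_time_nonpos by apply Rmin_l.
  apply Rmult_le_reg_r with a; [exact a_pos|].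
  replace (v1 / a * a) with v1 by (field; lra). rewrite Rmult_comm. apply Rmin_r. }
assert (H2 : x <= travel_time v2).
{ assert (P : 0 <= (a + k) * Rmax 0 x) by (apply Rmult_le_pos; [lra|apply Rmax_l]).
  assert (0 <= v2).
  { unfold v2. generalize (exp_ineq1_le ((a + k) * Rmax 0 x)). lra. }
  apply Rle_trans with (2 := travel_time_lower v2 H).
  unfold v2. replace (1 + (exp ((a + k) * Rmax 0 x) - 1)) with (exp ((a + k) * Rmax 0 x)) by ring.
  rewrite ln_exp. replace ((a + k) * Rmax 0 x / (a + k)) with (Rmax 0 x) by (field; lra).
  apply Rmax_r. }
destruct (IVT_gen travel_time v1 v2 x) as [v [_ Hv]].
- intros v. apply continuous_pt, travel_time_cont.
- split; [apply Rle_trans with (1 := Rmin_l _ _), H1|apply Rle_trans with (1 := H2), Rmax_r].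
- now exists v.
Qed.

(* The separable equation [v' = slope v] is solved by inverting the travel time. *)
Variable V : R -> R.
Hypothesis V_inv : forall x, travel_time (V x) = x.

Let V_derive x : is_derive V x (slope (V x)).
Proof. now apply (is_derive_inverse_flow slope travel_time). Qed.

Let V_cont x : continuous V x.
Proof. eapply is_derive_continuous, V_derive. Qed.

Let V_0 : V 0 = 0.
Proof. apply travel_time_inj. now rewrite V_inv, travel_time_0. Qed.

Let V_incr x y : x < y -> V x < V y.
Proof.
intros H. destruct (mean_value V (fun x => slope (V x)) x y H) as [z [Hz E]].
- intros; apply V_derive.
- intros; apply V_cont.
- assert (0 < slope (V z) * (y - x)); [|lra].
  apply Rmult_lt_0_compat; [apply slope_pos|lra].
Qed.

Let V_pos x : 0 < x -> 0 < V x.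
Proof. intros H. apply V_incr in H. now rewrite V_0 in H. Qed.

Let V_nonpos x : x <= 0 -> V x <= 0.
Proof.
intros H. destruct (Rle_lt_or_eq_dec _ _ H) as [H1| ->]; [|rewrite V_0; lra].
apply V_incr in H1. rewrite V_0 in H1. lra.
Qed.

(** [V] is nonpositive on the left half-line and [pw] is [0] there, so the extension by zero is
    built in. *)
Definition profile x := pw (V x) b.

Let profile_nonpos x : x <= 0 -> profile x = 0.
Proof. intros H. now apply pw_nonpos, V_nonpos. Qed.

Let profile_pos x : 0 < x -> 0 < profile x.
Proof. intros H. now apply pw_gt_0, V_pos. Qed.

Let profile_cont x : continuous profile x.
Proof.
apply (continuous_comp V (fun v => pw v b)); [apply V_cont|apply continuous_pw; lra].
Qed.

Let profile_derive x : 0 < x -> is_derive profile x (p (V x)).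
Proof.
intros H. generalize (V_pos x H). intros HV.
replace (p (V x)) with (slope (V x) * (b * pw (V x) b / V x)).
- apply (is_derive_comp (fun v => pw v b) V); [now apply is_derive_pw|apply V_derive].
- rewrite slope_pos_eq by exact HV. generalize (s_pos _ HV). unfold s.
  rewrite pw_minus_1 by exact HV. generalize (pw_gt_0 (V x) b HV). intros H1 H2.
  field. lra.
Qed.

(* [phi ^ (g - 1) = v ^ (beta - 2)] *)
Let forcing_eq v : 0 < v -> g * Rpower (pw v b) (g - 1) = 2 * (b - 1) / b * s v / v.
Proof.
intros H. rewrite <- (pw_pos (pw v b)) by (now apply pw_gt_0). rewrite pw_pw by exact H.
unfold s. replace (b * (g - 1)) with (b - 1 - 1).
- rewrite (pw_minus_1 v (b - 1)) by exact H. unfold b. rewrite <- beta_mult by exact hg.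
  fold b. field. lra.
- generalize (beta_mult g hg). fold b. lra.
Qed.

Let profile_derive2 x : 0 < x ->
  is_derive (Derive profile) x (g * Rpower (profile x) (g - 1) - c * p (V x)).
Proof.
intros H. generalize (V_pos x H). intros HV.
apply (is_derive_locally_eq (fun x => p (V x)) _ 0 x _ H).
{ intros z Hz. symmetry. now apply is_derive_unique, profile_derive. }
unfold profile. rewrite forcing_eq by exact HV.
replace (2 * (b - 1) / b * s (V x) / V x - c * p (V x))
  with (slope (V x) * (2 * (b - 1) * pw (V x) (b - 1) ^ 2 / (V x * p (V x)) - c * b * pw (V x) (b - 1))).
- apply (is_derive_comp p V); [now apply p_derive|apply V_derive].
- rewrite slope_pos_eq by exact HV. generalize (s_pos _ HV) (p_pos _ HV). unfold s. intros.
  field. lra.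
Qed.

Lemma profile_shape : shape_plus profile.
Proof.
split; [exact profile_nonpos|]. intros x Hx. split.
- eexists. now apply profile_derive.
- rewrite (is_derive_unique _ _ _ (profile_derive x Hx)). now apply p_pos, V_pos.
Qed.

Let gt_0_of_profile_pos x : 0 < profile x -> 0 < x.
Proof.
intros H. destruct (Rlt_le_dec 0 x) as [H1|H1]; [exact H1|].
rewrite profile_nonpos in H; lra.
Qed.

Lemma profile_admissible : admissible g c profile.
Proof.
repeat split.
- exact profile_cont.
- intros x. destruct (Rlt_le_dec 0 x) as [H|H].
  + left. now apply profile_pos.
  + right. now rewrite profile_nonpos.
- exists 1. apply Rgt_not_eq, profile_pos. lra.
- exists 0. rewrite profile_nonpos; lra.
- apply gt_0_of_profile_pos in H. eexists. now apply profile_derive.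
- apply gt_0_of_profile_pos in H. eexists. now apply profile_derive2.
- apply gt_0_of_profile_pos in H.
  apply continuous_ext_loc with (fun x => g * Rpower (profile x) (g - 1) - c * p (V x)).
  + apply (locally_gt _ 0 x H). intros z Hz. symmetry. now apply is_derive_unique, profile_derive2.
  + apply (continuous_minus (fun x => g * Rpower (profile x) (g - 1)) (fun x => c * p (V x))).
    * apply (continuous_mult (fun _ => g)); [apply continuous_const|].
      apply (continuous_comp profile (fun y => Rpower y (g - 1))); [apply profile_cont|].
      eapply is_derive_continuous, is_derive_Reals, derivable_pt_lim_power.
      now apply profile_pos.
    * apply (continuous_mult (fun _ => c) (fun x => p (V x))); [apply continuous_const|].
      apply (continuous_comp V p); [apply V_cont|apply p_cont].
- intros x Hx. apply gt_0_of_profile_pos in Hx.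
  rewrite (is_derive_unique _ _ _ (profile_derive x Hx)), (is_derive_unique _ _ _ (profile_derive2 x Hx)).
  ring.
- intros x0 [Hcl Hint].
  assert (E : x0 = 0).
  { destruct (Rtotal_order x0 0) as [H|[H|H]]; [exfalso|exact H|exfalso].
    - destruct (Hcl (- x0) ltac:(lra)) as [x [Hx Hp]]. apply gt_0_of_profile_pos in Hp.
      apply Rabs_lt_between in Hx. lra.
    - apply Hint. exists x0. split; [exact H|]. intros x Hx. apply profile_pos.
      apply Rabs_lt_between in Hx. lra. }
  subst x0. fold b. fold a.
  (* On the positivity set [profile ^ (1 / b)] is [V] itself, whose derivative [slope (V x)] tends
     to [slope 0 = a]. *)
  apply (filterlim_within_ext (posset profile) (fun x => Rabs (slope (V x)))).
  + intros x Hx. f_equal. symmetry. apply is_derive_unique.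
    apply gt_0_of_profile_pos in Hx.
    apply (is_derive_locally_eq V _ 0 x _ Hx); [|apply V_derive].
    intros z Hz. generalize (V_pos z Hz). intros HV. unfold profile. rewrite pw_pw by exact HV.
    replace (b * (1 / b)) with 1 by (field; lra). now rewrite pw_1.
  + apply (filterlim_filter_le_1 (F := locally 0) (fun x => Rabs (slope (V x)))).
    { intros P HP. unfold within. generalize HP. apply filter_imp. tauto. }
    replace a with (Rabs (slope (V 0))).
    * change (continuous (fun x => Rabs (slope (V x))) 0).
      apply (continuous_Rabs_comp (fun x => slope (V x))).
      apply (continuous_comp V slope); [apply V_cont|apply slope_cont].
    * rewrite V_0, slope_nonpos by lra. apply Rabs_right. lra.
Qed.

(** * Rigidity of admissible profiles *)

Lemma trajectory (psi : R -> R) (l r : R) : admissible g c psi -> psi l = 0 ->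
  (forall x, l < x < r -> 0 < psi x) ->
  forall x, l < x < r -> psi x = profile (x - l).
Proof.
intros [psi_cont [psi_nonneg [_ [_ [psi_C2 [psi_eq psi_bd]]]]]] psi_l psi_pos.
set (v := fun x => pw (psi x) (1 / b)).
assert (v_pos : forall x, l < x < r -> 0 < v x) by (intros; now apply pw_gt_0, psi_pos).
assert (v_cont : forall x, continuous v x).
{ intros x. apply (continuous_comp psi (fun y => pw y (1 / b))); [apply psi_cont|].
  apply continuous_pw. apply Rdiv_lt_0_compat; lra. }
assert (v_l : v l = 0) by (unfold v; rewrite psi_l; apply pw_nonpos; lra).
assert (psi_v : forall x, l < x < r -> psi x = pw (v x) b).
{ intros x Hx. unfold v. rewrite pw_pw by (now apply psi_pos).
  replace (1 / b * b) with 1 by (field; lra). rewrite pw_1; [reflexivity|now apply psi_pos]. }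
assert (dpsi : forall x, l < x < r -> is_derive psi x (Derive psi x)).
{ intros x Hx. apply Derive_correct, psi_C2, psi_pos, Hx. }
assert (dv : forall x, l < x < r -> is_derive v x (Derive psi x / (b * s (v x)))).
{ intros x Hx. replace (Derive psi x / (b * s (v x))) with (Derive psi x * (1 / b * v x / psi x)).
  - apply (is_derive_comp (fun y => pw y (1 / b)) psi); [now apply is_derive_pw, psi_pos|now apply dpsi].
  - unfold s. rewrite pw_minus_1 by (now apply v_pos). rewrite <- psi_v by exact Hx.
    generalize (v_pos x Hx) (psi_pos x Hx). intros. field. lra. }
(* [psi' = b s (v) v']: near [l] the free boundary condition, taken with tolerance [1], gives
   [|v'| < a + 1], while [s (v)] tends to [0]. *)
assert (small : forall eps, 0 < eps -> exists d, 0 < d /\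
          forall x, l < x < r -> x - l < d -> Rabs (Derive psi x) < eps).
{ intros eps He.
  destruct (Rlt_le_dec l r) as [Hlr|Hlr].
  2:{ exists 1. split; [lra|]. intros; lra. }
  assert (Hbd : in_boundary psi l).
  { split.
    - intros e Hpe. exists (l + Rmin e (r - l) / 2).
      generalize (Rmin_pos e (r - l) Hpe ltac:(lra)) (Rmin_l e (r - l)) (Rmin_r e (r - l)). intros.
      split; [apply Rabs_lt_between; lra|apply psi_pos; lra].
    - intros [e [Hpe H]]. specialize (H l). rewrite Rminus_diag, Rabs_R0 in H.
      specialize (H Hpe). lra. }
  destruct (proj1 (filterlim_locally _ _) (psi_bd l Hbd) (mkposreal 1 Rlt_0_1)) as [d1 H1].
  assert (sv_cont : continuous (fun x => s (v x)) l).
  { apply (continuous_comp v s); [apply v_cont|apply continuous_pw; lra]. }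
  assert (Ha : 0 < b * (a + 1)) by (apply Rmult_lt_0_compat; lra).
  destruct (eps_continuous _ _ sv_cont (eps / (b * (a + 1)))) as [d2 [Hd2 H2]].
  { now apply Rdiv_lt_0_compat. }
  exists (Rmin d1 d2). split; [apply Rmin_pos; [apply cond_pos|exact Hd2]|].
  intros x Hx Hxd.
  assert (Hxd1 := Rlt_le_trans _ _ _ Hxd (Rmin_l _ _)).
  assert (Hxd2 := Rlt_le_trans _ _ _ Hxd (Rmin_r _ _)).
  assert (K : Rabs (Rabs (Derive v x) - a) < 1).
  { apply (H1 x).
    - change (Rabs (x - l) < d1). rewrite Rabs_right; lra.
    - now apply psi_pos. }
  specialize (H2 x). rewrite Rabs_right in H2 by lra. specialize (H2 Hxd2). simpl in H2.
  rewrite v_l in H2. unfold s in H2 at 2. rewrite (pw_nonpos 0), Rminus_0_r in H2 by lra.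
  assert (sv := s_pos _ (v_pos x Hx)). rewrite Rabs_right in H2 by lra.
  rewrite (is_derive_unique _ _ _ (dv x Hx)) in K.
  replace (Derive psi x) with (b * s (v x) * (Derive psi x / (b * s (v x)))) by (field; lra).
  rewrite Rabs_mult, (Rabs_right (b * s (v x))) by (apply Rle_ge, Rmult_le_pos; lra).
  apply Rabs_lt_between in K.
  apply Rle_lt_trans with (b * s (v x) * (a + 1)).
  - apply Rmult_le_compat_l; [apply Rmult_le_pos; lra|]. lra.
  - apply (Rmult_lt_compat_r (b * (a + 1))) in H2; [|exact Ha].
    replace (eps / (b * (a + 1)) * (b * (a + 1))) with eps in H2 by (field; lra). lra. }
assert (dpv : forall x, l < x < r -> is_derive (fun x => p (v x)) x
   (Derive psi x / (b * s (v x)) * (2 * (b - 1) * pw (v x) (b - 1) ^ 2 / (v x * p (v x)) - c * b * pw (v x) (b - 1)))).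
{ intros x Hx. apply (is_derive_comp p v); [now apply p_derive, v_pos|now apply dv]. }
(* The drift contributes the same [- c psi'] to [psi''] and to the derivative of [p (v)], so the
   speed drops out of the equation for the defect. *)
assert (dD : forall x, l < x < r -> is_derive (fun x => Derive psi x - p (v x)) x
   (- (2 * (b - 1) / b * s (v x) / v x / p (v x)) * (Derive psi x - p (v x)))).
{ intros x Hx. assert (Hpsi := psi_pos x Hx).
  replace (- (2 * (b - 1) / b * s (v x) / v x / p (v x)) * (Derive psi x - p (v x)))
    with (Derive (Derive psi) x - Derive psi x / (b * s (v x)) * (2 * (b - 1) * pw (v x) (b - 1) ^ 2 / (v x * p (v x)) - c * b * pw (v x) (b - 1))).
  - apply (is_derive_minus (Derive psi) (fun x => p (v x))); [|now apply dpv].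
    apply Derive_correct, psi_C2, Hpsi.
  - assert (E := psi_eq x Hpsi). rewrite (psi_v x Hx) in E. rewrite forcing_eq in E by (now apply v_pos).
    replace (Derive (Derive psi) x) with (2 * (b - 1) / b * s (v x) / v x - c * Derive psi x) by lra.
    generalize (v_pos x Hx) (s_pos _ (v_pos x Hx)) (p_pos _ (v_pos x Hx)). unfold s. intros.
    field. lra. }
assert (D0 : forall x, l < x < r -> Derive psi x = p (v x)).
{ intros x Hx. apply cond_eq. intros eps He.
  destruct (small (eps / 2)) as [d1 [Hd1 H1]]; [lra|].
  assert (C : continuous (fun x => p (v x)) l).
  { apply (continuous_comp v p); [apply v_cont|apply p_cont]. }
  destruct (eps_continuous _ _ C (eps / 2)) as [d2 [Hd2 H2]]; [lra|].
  (* The point [l + d] lies strictly between [l] and [x] and is so close to [l] that [psi'] and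
     [p (v)] are both below [eps / 2] there. *)
  set (d := Rmin (Rmin d1 d2) (x - l) / 2).
  assert (Hd : 0 < d).
  { unfold d. generalize (Rmin_pos (Rmin d1 d2) (x - l) (Rmin_pos _ _ Hd1 Hd2) ltac:(lra)). lra. }
  assert (d < d1 /\ d < d2 /\ d < x - l) as [Hdd1 [Hdd2 Hdx]].
  { unfold d in *. generalize (Rmin_l (Rmin d1 d2) (x - l)) (Rmin_r (Rmin d1 d2) (x - l))
      (Rmin_l d1 d2) (Rmin_r d1 d2). lra. }
  specialize (H1 (l + d) ltac:(lra) ltac:(lra)).
  specialize (H2 (l + d)). replace (l + d - l) with d in H2 by ring.
  rewrite (Rabs_right d) in H2 by lra. specialize (H2 Hdd2). simpl in H2.
  rewrite v_l, p_0, Rminus_0_r in H2.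
  assert (M : - (Derive psi (l + d) - p (v (l + d))) ^ 2 <= - (Derive psi x - p (v x)) ^ 2).
  { assert (dD2 : forall z, l < z < r -> is_derive (fun x => - (Derive psi x - p (v x)) ^ 2) z
       (2 * (2 * (b - 1) / b * s (v z) / v z / p (v z)) * (Derive psi z - p (v z)) ^ 2)).
    { intros z Hz.
      replace (2 * (2 * (b - 1) / b * s (v z) / v z / p (v z)) * (Derive psi z - p (v z)) ^ 2)
        with (- (2 * (b - 1) / b * s (v z) / v z / p (v z)) * (Derive psi z - p (v z)) *
              (- (2 * (Derive psi z - p (v z))))) by ring.
      apply (is_derive_comp (fun y => - y ^ 2) (fun x => Derive psi x - p (v x))); [|now apply dD].
      auto_derive; [easy|ring]. }
    apply (nondecreasing_of_derive (fun x => - (Derive psi x - p (v x)) ^ 2) (l + d) x); [lra| |].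
    - intros z Hz. eexists. split; [apply dD2; lra|].
      assert (Hz' : l < z < r) by lra.
      generalize (v_pos z Hz') (s_pos _ (v_pos z Hz')) (p_pos _ (v_pos z Hz')). intros.
      apply Rmult_le_pos; [|apply pow2_ge_0]. apply Rmult_le_pos; [lra|].
      repeat (apply Rdiv_le_0_compat; [|lra]). apply Rmult_le_pos; [|lra].
      apply Rdiv_le_0_compat; lra.
    - intros z Hz. eapply is_derive_continuous, dD2. lra. }
  apply Rabs_lt_between in H1. apply Rabs_lt_between in H2. apply Rabs_lt_between.
  split; nra. }
intros x Hx.
(* Since [psi' = p (v)], the travel time of [v] advances at unit speed; hence
   [travel_time (v x) = x - l], which [V] inverts. *)
assert (dT : forall z, l < z < r -> is_derive (fun x => travel_time (v x)) z 1).
{ intros z Hz. replace 1 with (Derive psi z / (b * s (v z)) * (/ slope (v z))).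
  - apply (is_derive_comp travel_time v); [apply travel_time_derive|now apply dv].
  - assert (Hv := v_pos z Hz). rewrite D0, slope_pos_eq by assumption.
    generalize (s_pos _ Hv) (p_pos _ Hv). intros. field. lra. }
destruct (mean_value (fun x => travel_time (v x)) (fun _ => 1) l x (proj1 Hx)) as [z [_ E]].
- intros z Hz. apply dT. lra.
- intros z _. apply (continuous_comp v travel_time); [apply v_cont|apply travel_time_cont].
- rewrite v_l, travel_time_0 in E. rewrite psi_v by exact Hx. unfold profile. f_equal.
  apply travel_time_inj. rewrite V_inv. lra.
Qed.

(** If [psi] came back to [0] at a first point [r], it would equal [profile (x - l)] on [(l, r)].
    That translate is positive at [r], which contradicts continuity. *)
Let half_line (psi : R -> R) (x0 x1 : R) : admissible g c psi -> psi x0 = 0 ->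
  x0 < x1 -> 0 < psi x1 ->
  exists l, x0 <= l < x1 /\ psi l = 0 /\ forall x, l < x -> psi x = profile (x - l).
Proof.
intros Hadm H0 H01 H1. assert (Hadm' := Hadm). destruct Hadm' as [psi_cont [psi_nonneg _]].
destruct (last_zero psi x0 x1 psi_cont psi_nonneg H01 H0 H1) as [l [Hl [psi_l psi_pos]]].
exists l. split; [exact Hl|]. split; [exact psi_l|].
assert (pos : forall x, l < x -> 0 < psi x).
{ intros x Hx. destruct (Rle_lt_dec x x1) as [Hx1|Hx1]; [apply psi_pos; lra|].
  destruct (Rle_lt_or_eq_dec _ _ (psi_nonneg x)) as [H|H]; [exact H|exfalso].
  destruct (first_zero psi x1 x psi_cont psi_nonneg Hx1 H1 (eq_sym H)) as [r [Hr [psi_r pos_r]]].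
  assert (E := trajectory psi l r Hadm psi_l).
  assert (pos' : forall x, l < x < r -> 0 < psi x).
  { intros y Hy. destruct (Rle_lt_dec y x1); [apply psi_pos|apply pos_r]; lra. }
  specialize (E pos').
  assert (C : continuous (fun x => psi x - profile (x - l)) r).
  { apply (continuous_minus psi (fun x => profile (x - l))); [apply psi_cont|].
    apply (continuous_comp (fun x => x - l) profile); [|apply profile_cont].
    apply (ex_derive_continuous (fun x => x - l)). auto_derive. easy. }
  assert (Pr : 0 < profile (r - l)) by (apply profile_pos; lra).
  destruct (eps_continuous _ _ C _ Pr) as [d [Hd Hy]].
  set (y := r - Rmin d (r - l) / 2).
  generalize (Rmin_pos d (r - l) Hd ltac:(lra)) (Rmin_l d (r - l)) (Rmin_r d (r - l)). intros.
  specialize (Hy y). rewrite E in Hy by (unfold y; lra).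
  assert (Ay : Rabs (y - r) < d) by (unfold y; apply Rabs_lt_between; lra).
  specialize (Hy Ay). rewrite psi_r in Hy. apply Rabs_lt_between in Hy. lra. }
intros x Hx. apply (trajectory psi l (x + 1)); [exact Hadm|exact psi_l| |lra].
intros y Hy. apply pos. lra.
Qed.

(** Uniqueness and the classification are both drawn from this dichotomy, the left of [x0] being
    reached by reflection. *)
Lemma profile_to_the_right (psi : R -> R) (x0 : R) : admissible g c psi -> psi x0 = 0 ->
  (forall x, x0 <= x -> psi x = 0) \/
  exists l, x0 <= l /\ forall x, x0 <= x -> psi x = profile (x - l).
Proof.
intros Hadm H0. assert (psi_nonneg := proj1 (proj2 Hadm)).
destruct (Classical_Prop.classic (exists x1, x0 < x1 /\ 0 < psi x1)) as [[x1 [H01 H1]]|H].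
- right. destruct (half_line psi x0 x1 Hadm H0 H01 H1) as [l [Hl [psi_l E]]].
  exists l. split; [lra|]. intros x Hx.
  destruct (Rlt_le_dec l x) as [Hlx|Hlx]; [now apply E|].
  rewrite profile_nonpos by lra.
  destruct (Rle_lt_or_eq_dec _ _ (psi_nonneg x)) as [Hp|Hp]; [exfalso|now symmetry].
  destruct (Rle_lt_or_eq_dec _ _ Hx) as [Hx'|Hx']; [|subst; lra].
  (* A positive value between [x0] and [l] would start another half-line, and this one would contain
     [l], where [psi] vanishes. *)
  destruct (half_line psi x0 x Hadm H0 Hx' Hp) as [l2 [Hl2 [_ E2]]].
  specialize (E2 l ltac:(lra)).
  assert (0 < profile (l - l2)) by (apply profile_pos; lra). lra.
- left. intros x Hx. destruct (Rle_lt_or_eq_dec _ _ Hx) as [Hx'|Hx']; [|now subst].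
  destruct (Rle_lt_or_eq_dec _ _ (psi_nonneg x)) as [Hp|Hp]; [exfalso|now symmetry].
  apply H. now exists x.
Qed.

(** * Behaviour at infinity *)

Let profile_to_p_infty : filterlim profile (Rbar_locally p_infty) (Rbar_locally p_infty).
Proof.
(* Beyond this point [V x > Rmax 1 M]; the [1] serves for [V x ^ b >= V x], as [b > 1]. *)
intros P [M HM]. exists (Rmax 0 (travel_time (Rmax 1 M))). intros x Hx. apply HM.
assert (H1 := Rle_lt_trans _ _ _ (Rmax_r _ _) Hx).
assert (HV : Rmax 1 M < V x).
{ destruct (Rlt_le_dec (Rmax 1 M) (V x)) as [H|H]; [exact H|exfalso].
  rewrite <- (V_inv x) in H1 at 1.
  destruct (Rle_lt_or_eq_dec _ _ H) as [H2|H2]; [apply travel_time_incr in H2|rewrite H2 in H1]; lra. }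
generalize (Rmax_l 1 M) (Rmax_r 1 M). intros.
apply Rlt_le_trans with (V x); [lra|]. unfold profile. rewrite pw_pos by lra.
rewrite <- (Rpower_1 (V x)) at 1 by lra. apply Rle_Rpower; lra.
Qed.

(** For [c = 0] both [B] and [k] vanish, so the two bounds on [slope] coincide, [V x = a x] for
    [x > 0], and [a ^ b] is [c_beta]. *)
Let profile_c_0 : c = 0 -> forall x, profile x = c_beta g * pw (Rmax x 0) b.
Proof.
intros c0 x. destruct (Rle_lt_dec x 0) as [H|H].
{ rewrite profile_nonpos by exact H. rewrite Rmax_right by exact H.
  rewrite pw_nonpos; lra. }
assert (k0 : k = 0) by (unfold k; rewrite c0, Ropp_0; apply Rmax_left; lra).
assert (B0 : B = 0) by (unfold B, phase_decay; rewrite c0, Rabs_R0; unfold Rdiv; ring).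
assert (sl : forall v, slope v = a).
{ intros v. destruct (Rle_lt_dec v 0) as [Hv|Hv]; [now apply slope_nonpos|].
  generalize (slope_lower v Hv) (slope_upper v Hv).
  rewrite k0, B0, !Rmult_0_l, !Rplus_0_r. unfold Rdiv. rewrite Rinv_1. lra. }
assert (E : V x = a * x).
{ destruct (mean_value V (fun _ => a) 0 x H) as [z [_ E]].
  - intros z _. rewrite <- (sl (V z)). apply V_derive.
  - intros; apply V_cont.
  - rewrite V_0 in E. lra. }
unfold profile, c_beta. fold b. rewrite E, Rmax_left, !pw_pos by (try lra; now apply Rmult_lt_0_compat).
replace (2 / b ^ 2) with (Rpower a 2).
- rewrite Rpower_mult. replace (2 * (b / 2)) with b by field.
  symmetry. apply Rpower_mult_distr; lra.
- replace 2 with (INR 2) at 1 by (simpl; ring). rewrite Rpower_pow by exact a_pos.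
  unfold a. replace ((sqrt 2 / b) ^ 2) with (sqrt 2 * sqrt 2 / b ^ 2) by (field; lra).
  rewrite sqrt_sqrt; lra.
Qed.

(** The phase equation in terms of [slope]. For [c > 0], with [slope ^ 2] negligible, the balance
    [c = (b - 1) a ^ 2 / (v slope)] predicts the limit of [v * slope v]. *)
Let slope_derive v : 0 < v ->
  is_derive slope v (- c + (b - 1) * (a ^ 2 - slope v ^ 2) / (v * slope v)).
Proof.
intros H. generalize (s_pos v H) (p_pos v H). intros Hs Hp.
apply (is_derive_locally_eq (fun v => p v / (b * s v)) _ 0 v _ H).
{ intros z Hz. symmetry. now apply slope_pos_eq. }
rewrite slope_pos_eq by exact H.
replace (- c + (b - 1) * (a ^ 2 - (p v / (b * s v)) ^ 2) / (v * (p v / (b * s v))))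
  with (((2 * (b - 1) * pw v (b - 1) ^ 2 / (v * p v) - c * b * pw v (b - 1)) * (b * s v)
          - p v * (b * ((b - 1) * s v / v))) / (b * s v) ^ 2).
- apply (is_derive_div p (fun v => b * s v));
    [now apply p_derive| |apply Rgt_not_eq, Rmult_lt_0_compat; lra].
  apply (is_derive_scal s v b). exact (is_derive_pw v (b - 1) H).
- unfold a. replace ((sqrt 2 / b) ^ 2) with (sqrt 2 * sqrt 2 / b ^ 2) by (field; lra).
  rewrite sqrt_sqrt by lra. unfold s in *. field. lra.
Qed.

(** Since [B = a / K0], the known lower bound [v a / (1 + B v)] already tends to [K0]. For the upper
    half, while [v slope] is at least [K > K0] and [v] is large, its derivative is at most [- 1]; so
    it falls to [K] and never crosses back. *)
Let slope_rate : 0 < c ->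
  filterlim (fun v => v * slope v) (Rbar_locally p_infty) (locally ((b - 1) * a ^ 2 / c)).
Proof.
intros c0. set (K0 := (b - 1) * a ^ 2 / c).
assert (K0_pos : 0 < K0).
{ unfold K0. apply Rdiv_lt_0_compat; [|exact c0]. apply Rmult_lt_0_compat; [lra|]. now apply pow_lt. }
assert (k0 : k = 0) by (unfold k; apply Rmax_left; lra).
assert (EB : B = a / K0).
{ unfold K0, B, phase_decay, a. rewrite Rabs_right by lra. field.
  repeat split; lra. }
assert (B_pos : 0 < B) by (rewrite EB; now apply Rdiv_lt_0_compat).
apply filterlim_p_infty_eps. intros eps He.
(* [delta] is the excess of [c] over the balance value at level [K]. Past [v0] the damping
   [delta v >= a + 1] outweighs the remaining term [(2 - b) slope <= a] by [1]. *)
set (K := K0 + eps / 2). set (delta := c - (b - 1) * a ^ 2 / K).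
assert (K_pos : 0 < K) by (unfold K; lra).
assert (delta_pos : 0 < delta).
{ unfold delta. replace ((b - 1) * a ^ 2) with (K0 * c) by (unfold K0; field; lra).
  replace (c - K0 * c / K) with (c * (eps / 2) / K) by (unfold K; field; unfold K in K_pos; lra).
  apply Rdiv_lt_0_compat; [apply Rmult_lt_0_compat; lra|exact K_pos]. }
set (v0 := (a + 1) / delta).
assert (v0_pos : 0 < v0) by (apply Rdiv_lt_0_compat; lra).
set (dN := fun v => slope v + v * (- c + (b - 1) * (a ^ 2 - slope v ^ 2) / (v * slope v))).
assert (Nd : forall v, 0 < v -> is_derive (fun v => v * slope v) v (dN v)).
{ intros v Hv. replace (dN v) with (1 * slope v + v * (- c + (b - 1) * (a ^ 2 - slope v ^ 2) / (v * slope v)))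
    by (unfold dN; ring).
  apply (is_derive_mult (fun v => v) slope); [apply (is_derive_id v)|now apply slope_derive|intros; apply Rmult_comm]. }
assert (dN_neg : forall v, v0 <= v -> K <= v * slope v -> dN v <= -1).
{ intros v Hv HK. assert (v_pos : 0 < v) by lra.
  assert (sl := slope_pos v). assert (su := slope_upper v v_pos). rewrite k0, Rmult_0_l, Rplus_0_r in su.
  apply (Rmult_le_compat_r delta) in Hv; [|lra].
  replace (v0 * delta) with (a + 1) in Hv by (unfold v0; field; lra).
  replace (dN v) with ((2 - b) * slope v - c * v + (b - 1) * a ^ 2 * v * / (v * slope v))
    by (unfold dN; field; lra).
  assert (I : / (v * slope v) <= / K) by (now apply Rinv_le_contravar).
  apply (Rmult_le_compat_l ((b - 1) * a ^ 2 * v)) in I.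
  2:{ apply Rmult_le_pos; [|lra]. apply Rmult_le_pos; [lra|apply pow2_ge_0]. }
  assert ((2 - b) * slope v <= a) by nra.
  assert (v * delta = c * v - (b - 1) * a ^ 2 * v * / K) by (unfold delta; field; lra).
  lra. }
assert (Nc : forall v, continuous (fun v => v * slope v) v).
{ intros v. apply (continuous_mult (fun v => v) slope); [apply continuous_id|apply slope_cont]. }
assert (V1 : exists v1, v0 <= v1 /\ v1 * slope v1 <= K).
{ destruct (Classical_Prop.classic (exists v1, v0 <= v1 /\ v1 * slope v1 <= K)) as [H|H]; [exact H|exfalso].
  assert (HN : forall v, v0 <= v -> K < v * slope v).
  { intros v Hv. destruct (Rlt_le_dec K (v * slope v)); [assumption|].
    exfalso. apply H. now exists v. }
  (* [v slope + v] would be nonincreasing from [v0] on, so that [v slope] would be at most [0] at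
     [v0 + N0]. *)
  set (N0 := v0 * slope v0).
  assert (HN0 := HN v0 (Rle_refl _)). fold N0 in HN0.
  assert (A : - (v0 * slope v0) - v0 <= - ((v0 + N0) * slope (v0 + N0)) - (v0 + N0)).
  { assert (Fd : forall v, 0 < v -> is_derive (fun v => - (v * slope v) - v) v (- dN v - 1)).
    { intros v Hv. apply (is_derive_minus (fun v => - (v * slope v)) (fun v => v)); [|apply (is_derive_id v)].
      apply (is_derive_opp (fun v => v * slope v)). now apply Nd. }
    apply (nondecreasing_of_derive (fun v => - (v * slope v) - v) v0 (v0 + N0)); [lra| |].
    - intros v Hv. eexists. split; [apply Fd; lra|].
      generalize (dN_neg v ltac:(lra) ltac:(generalize (HN v); lra)). lra.
    - intros v Hv. eapply is_derive_continuous, Fd. lra. }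
  fold N0 in A. generalize (HN (v0 + N0) ltac:(lra)). lra. }
destruct V1 as [v1 [Hv1 HK1]].
assert (upper : forall v, v1 <= v -> v * slope v <= K).
{ intros v Hv. apply Rminus_le_0.
  apply (barrier (fun v => K - v * slope v) v1 v); [exact Hv|lra| | |].
  - intros x _. apply (continuous_minus (fun _ => K) (fun v => v * slope v)); [apply continuous_const|apply Nc].
  - intros x Hx Hneg. exists (0 - dN x). split.
    + apply (is_derive_minus (fun _ => K) (fun v => v * slope v)); [apply (is_derive_const K x)|apply Nd; lra].
    + generalize (dN_neg x ltac:(lra) ltac:(lra)). lra.
  - intros x Hx. exists (0 - dN x).
    apply (is_derive_minus (fun _ => K) (fun v => v * slope v)); [apply (is_derive_const K x)|apply Nd; lra]. }
exists (Rmax v1 (K0 / (B * eps))). intros v Hv.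
assert (H1 := Rle_lt_trans _ _ _ (Rmax_l _ _) Hv).
assert (H2 := Rle_lt_trans _ _ _ (Rmax_r _ _) Hv).
assert (v_pos : 0 < v) by lra.
generalize (upper v ltac:(lra)). unfold K. intros Hu.
assert (lo := slope_lower v v_pos). apply (Rmult_le_compat_l v) in lo; [|lra].
apply (Rmult_lt_compat_r (B * eps)) in H2; [|apply Rmult_lt_0_compat; lra].
replace (K0 / (B * eps) * (B * eps)) with K0 in H2 by (field; lra).
assert (Bv : 0 < B * v) by (now apply Rmult_lt_0_compat).
assert (Hl : K0 - eps < v * (a / (1 + B * v))).
{ apply Rmult_lt_reg_r with (1 + B * v); [lra|].
  replace (v * (a / (1 + B * v)) * (1 + B * v)) with (v * a) by (field; lra).
  replace a with (B * K0) by (rewrite EB; field; lra). nra. }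
apply Rabs_lt_between. lra.
Qed.

(** [(V ^ 2)' = 2 V slope (V)] tends to [2 K0 = 2 g / (b c)], hence so does [V ^ 2 / x], and the
    profile is [(V ^ 2) ^ (b / 2)]. *)
Let profile_c_pos : 0 < c ->
  equiv_pinf profile (fun x => pw (2 * g / (b * c) * x) (b / 2)).
Proof.
intros c0. set (K0 := (b - 1) * a ^ 2 / c).
assert (K0_pos : 0 < K0).
{ unfold K0. apply Rdiv_lt_0_compat; [|exact c0]. apply Rmult_lt_0_compat; [lra|]. now apply pow_lt. }
assert (EK : 2 * g / (b * c) = 2 * K0).
{ unfold K0, a. replace ((sqrt 2 / b) ^ 2) with (sqrt 2 * sqrt 2 / b ^ 2) by (field; lra).
  rewrite sqrt_sqrt by lra. replace g with (2 * (b - 1) / b).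
  - field. lra.
  - unfold b. rewrite <- beta_mult by exact hg. fold b. field. lra. }
assert (W : filterlim (fun x => V x ^ 2 / x) (Rbar_locally p_infty) (locally (2 * K0))).
{ apply (average_of_derive_limit (fun x => V x ^ 2) (fun x => 2 * (V x * slope (V x)))).
  - intros x _. replace (2 * (V x * slope (V x))) with (slope (V x) * (2 * V x)) by ring.
    apply (is_derive_comp (fun v => v ^ 2) V); [|apply V_derive].
    auto_derive; [easy|ring].
  - apply (filterlim_comp _ _ _ (fun x => V x * slope (V x)) (fun y => 2 * y) _ (locally K0)).
    + apply (filterlim_comp _ _ _ V (fun v => v * slope v) _ (Rbar_locally p_infty)).
      * intros P [M HM]. exists (travel_time M). intros x Hx. apply HM.
        destruct (Rlt_le_dec M (V x)) as [H|H]; [exact H|exfalso].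
        rewrite <- (V_inv x) in Hx.
        destruct (Rle_lt_or_eq_dec _ _ H) as [H2|H2];
          [apply travel_time_incr in H2|rewrite H2 in Hx]; lra.
      * now apply slope_rate.
    + apply (ex_derive_continuous (fun y => 2 * y)). auto_derive. easy. }
unfold equiv_pinf.
apply (filterlim_ext_loc (fun x => Rpower (V x ^ 2 / x * / (2 * K0)) (b / 2))).
- exists 0. intros x Hx. assert (HV := V_pos x Hx).
  assert (HV2 : 0 < V x ^ 2) by (now apply pow_lt).
  rewrite EK. unfold profile. rewrite !pw_pos; [|apply Rmult_lt_0_compat; lra|exact HV].
  replace (V x ^ 2 / x * / (2 * K0)) with (V x ^ 2 * / (2 * K0 * x)) by (field; lra).
  rewrite <- Rpower_mult_distr; [|exact HV2|apply Rinv_0_lt_compat, Rmult_lt_0_compat; lra].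
  unfold Rdiv at 3. f_equal.
  + rewrite <- (Rpower_pow 2) by exact HV. rewrite Rpower_mult. f_equal. simpl. field.
  + unfold Rpower. rewrite ln_Rinv by (apply Rmult_lt_0_compat; lra).
    rewrite Ropp_mult_distr_r_reverse, exp_Ropp. reflexivity.
- apply (filterlim_comp _ _ _ (fun x => V x ^ 2 / x) (fun y => Rpower (y * / (2 * K0)) (b / 2)) _ (locally (2 * K0)));
    [exact W|].
  assert (C : continuous (fun y => Rpower (y * / (2 * K0)) (b / 2)) (2 * K0)).
  { apply (continuous_comp (fun y => y * / (2 * K0)) (fun y => Rpower y (b / 2))).
    - apply (ex_derive_continuous (fun y => y * / (2 * K0))). auto_derive. easy.
    - eapply is_derive_continuous, is_derive_Reals, derivable_pt_lim_power.
      rewrite Rinv_r; lra. }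
  assert (E1 : Rpower (2 * K0 * / (2 * K0)) (b / 2) = 1).
  { rewrite Rinv_r by lra. unfold Rpower. rewrite ln_1, Rmult_0_r. apply exp_0. }
  red in C. cbv beta in C. rewrite E1 in C. exact C.
Qed.

(** [h = phi' + c phi] has the forcing as derivative, which is bounded beyond [1] because [phi]
    increases and [g <= 1]. So [h] is nonnegative and grows at most linearly, and
    [(phi exp (c x))' = h exp (c x)] makes [phi exp (c x)] monotone and bounded. *)
Let profile_c_neg : c < 0 ->
  exists K, 0 < K /\ equiv_pinf profile (fun x => K * exp (- c * x)).
Proof.
intros c0. set (kap := - c). assert (kap_pos : 0 < kap) by (unfold kap; lra).
set (h := fun x => p (V x) - kap * profile x).
assert (hc : forall x, continuous h x).
{ intros x. apply (continuous_minus (fun x => p (V x)) (fun x => kap * profile x)).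
  - apply (continuous_comp V p); [apply V_cont|apply p_cont].
  - apply (continuous_mult (fun _ => kap) profile); [apply continuous_const|apply profile_cont]. }
assert (hd : forall x, 0 < x -> is_derive h x (g * Rpower (profile x) (g - 1))).
{ intros x Hx.
  apply (is_derive_locally_eq (fun x => Derive profile x - kap * profile x) _ 0 x _ Hx).
  { intros z Hz. unfold h. now rewrite (is_derive_unique _ _ _ (profile_derive z Hz)). }
  replace (g * Rpower (profile x) (g - 1)) with
    (g * Rpower (profile x) (g - 1) - c * p (V x) - kap * p (V x)) by (unfold kap; ring).
  apply (is_derive_minus (Derive profile) (fun x => kap * profile x)); [now apply profile_derive2|].
  apply (is_derive_scal profile x kap). now apply profile_derive. }
assert (forcing_pos : forall x, 0 < g * Rpower (profile x) (g - 1)).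
{ intros x. apply Rmult_lt_0_compat; [lra|apply exp_pos]. }
assert (h_nonneg : forall x, 0 <= x -> 0 <= h x).
{ intros x Hx. replace 0 with (h 0) at 1.
  - apply (nondecreasing_of_derive h 0 x Hx).
    + intros z Hz. eexists. split; [apply hd; lra|]. left. apply forcing_pos.
    + intros; apply hc.
  - unfold h. rewrite V_0, p_0, profile_nonpos; lra. }
set (C := g * Rpower (profile 1) (g - 1)).
assert (C_pos : 0 < C) by apply forcing_pos.
assert (profile_incr : forall x, 1 <= x -> profile 1 <= profile x).
{ intros x Hx. apply (nondecreasing_of_derive profile 1 x Hx).
  - intros z Hz. eexists. split; [apply profile_derive; lra|]. left. apply p_pos, V_pos. lra.
  - intros; apply profile_cont. }
assert (forcing_le : forall x, 1 <= x -> g * Rpower (profile x) (g - 1) <= C).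
{ intros x Hx. apply Rmult_le_compat_l; [lra|].
  assert (P1 : 0 < profile 1) by (apply profile_pos; lra).
  replace (g - 1) with (- (1 - g)) by ring. rewrite !Rpower_Ropp.
  apply Rinv_le_contravar; [apply exp_pos|]. apply Rle_Rpower_l; [lra|].
  split; [exact P1|now apply profile_incr]. }
assert (h_le : forall x, 1 <= x -> h x <= h 1 + C * (x - 1)).
{ intros x Hx.
  assert (D : forall z, 0 < z -> is_derive (fun x => C * x - h x) z (C * 1 - g * Rpower (profile z) (g - 1))).
  { intros z Hz. apply (is_derive_minus (fun x => C * x) h); [|now apply hd].
    apply (is_derive_scal (fun x => x) z C), (is_derive_id z). }
  assert (A := nondecreasing_of_derive (fun x => C * x - h x) 1 x Hx).
  simpl in A.
  assert (C * 1 - h 1 <= C * x - h x); [apply A|lra].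
  - intros z Hz. eexists. split; [apply D; lra|]. generalize (forcing_le z). lra.
  - intros z Hz. eapply is_derive_continuous, D. lra. }
set (f := fun x => profile x * exp (- kap * x)).
assert (fd : forall x, 0 < x -> is_derive f x (h x * exp (- kap * x))).
{ intros x Hx.
  replace (h x * exp (- kap * x)) with (p (V x) * exp (- kap * x) + profile x * (- kap * exp (- kap * x)))
    by (unfold h; ring).
  apply (is_derive_mult profile (fun x => exp (- kap * x)));
    [now apply profile_derive|auto_derive; [easy|ring]|intros; apply Rmult_comm]. }
(* The antiderivative, vanishing at infinity, of the linear bound on [h] times [exp (- kap x)];
   being nonpositive, it yields [f x <= f 1 - Q 1]. *)
set (Q := fun x => - ((h 1 + C * (x - 1)) / kap + C / kap ^ 2) * exp (- kap * x)).
assert (Qd : forall x, is_derive Q x ((h 1 + C * (x - 1)) * exp (- kap * x))).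
{ intros x. unfold Q. auto_derive; [easy|]. field. lra. }
assert (Q_neg : forall x, 1 <= x -> Q x <= 0).
{ intros x Hx. unfold Q. rewrite Ropp_mult_distr_l_reverse. apply Ropp_le_cancel. rewrite Ropp_0, Ropp_involutive.
  apply Rmult_le_pos; [|left; apply exp_pos].
  assert (0 <= C * (x - 1)) by (apply Rmult_le_pos; lra).
  apply Rplus_le_le_0_compat; apply Rdiv_le_0_compat;
    [generalize (h_nonneg 1); lra|lra|lra|now apply pow_lt]. }
destruct (bounded_monotone_limit f 1 (f 1 - Q 1)) as [K [HK HL]].
- intros x y Hxy. apply (nondecreasing_of_derive f x y); [lra| |].
  + intros z Hz. eexists. split; [apply fd; lra|].
    apply Rmult_le_pos; [apply h_nonneg; lra|left; apply exp_pos].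
  + intros z Hz. eapply is_derive_continuous, fd. lra.
- intros x Hx.
  assert (D : forall z, 0 < z -> is_derive (fun x => Q x - f x) z
     ((h 1 + C * (z - 1)) * exp (- kap * z) - h z * exp (- kap * z))).
  { intros z Hz. apply (is_derive_minus Q f); [apply Qd|now apply fd]. }
  assert (Q 1 - f 1 <= Q x - f x); [|generalize (Q_neg x Hx); lra].
  apply (nondecreasing_of_derive (fun x => Q x - f x) 1 x Hx).
  + intros z Hz. eexists. split; [apply D; lra|].
    apply -> Rminus_le_0. apply Rmult_le_compat_r; [left; apply exp_pos|]. apply h_le. lra.
  + intros z Hz. eapply is_derive_continuous, D. lra.
- assert (K_pos : 0 < K).
  { apply Rlt_le_trans with (2 := HK). apply Rmult_lt_0_compat; [apply profile_pos; lra|apply exp_pos]. }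
  exists K. split; [exact K_pos|]. unfold equiv_pinf.
  apply (filterlim_ext (fun x => f x * / K)).
  + intros x. unfold f. fold kap. rewrite Ropp_mult_distr_l_reverse, exp_Ropp.
    field. split; [|lra]. apply Rgt_not_eq, exp_pos.
  + apply (filterlim_comp _ _ _ f (fun y => y * / K) _ (locally K)); [exact HL|].
    assert (C1 : continuous (fun y => y * / K) K).
    { apply (ex_derive_continuous (fun y => y * / K)). auto_derive. easy. }
    red in C1. cbv beta in C1. rewrite Rinv_r in C1 by lra. exact C1.
Qed.

Lemma profile_asymp : asymp_plus g c profile.
Proof.
split; [exact profile_to_p_infty|]. split; [exact profile_c_0|].
split; [exact profile_c_pos|exact profile_c_neg].
Qed.

End Profile.

Lemma increasing_profile_exists (g c : R) : 0 < g <= 1 -> exists phi : R -> R,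
  admissible g c phi /\ shape_plus phi /\ asymp_plus g c phi /\
  forall psi x0, admissible g c psi -> psi x0 = 0 ->
    (forall x, x0 <= x -> psi x = 0) \/
    exists l, x0 <= l /\ forall x, x0 <= x -> psi x = phi (x - l).
Proof.
intros hg.
destruct (phase_function_exists (beta g) c (beta_gt_1 g hg)) as [p [p_cont [p_derive [p_lower p_upper]]]].
destruct (functional_choice (fun x v => travel_time g p v = x)
  (travel_time_surj g c hg p p_cont p_lower p_upper)) as [V V_inv].
exists (profile g V). split; [|split; [|split]].
- now apply (profile_admissible g c hg p p_cont p_derive p_lower p_upper).
- now apply (profile_shape g c hg p p_cont p_lower p_upper).
- now apply (profile_asymp g c hg p p_cont p_derive p_lower p_upper).
- intros psi x0. now apply (profile_to_the_right g c hg p p_cont p_derive p_lower p_upper).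
Qed.

(** * Reflection *)

Lemma is_derive_reflect (f : R -> R) (x l : R) : is_derive f (- x) l ->
  is_derive (fun y => f (- y)) x (- l).
Proof.
intros H. replace (- l) with (-1 * l) by ring.
apply (is_derive_comp f Ropp); [exact H|]. auto_derive; [easy|ring].
Qed.

Lemma continuous_reflect (f : R -> R) (x : R) : continuous f (- x) ->
  continuous (fun y => f (- y)) x.
Proof.
intros H. apply (continuous_comp Ropp f); [|exact H].
apply (ex_derive_continuous Ropp). auto_derive. easy.
Qed.

Lemma locally_reflect (P : R -> Prop) (x : R) : locally (- x) P -> locally x (fun y => P (- y)).
Proof.
intros [d H]. exists d. intros y Hy. apply H.
change (Rabs (- y - - x) < d). change (Rabs (y - x) < d) in Hy.
replace (- y - - x) with (- (y - x)) by ring. now rewrite Rabs_Ropp.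
Qed.

Lemma filterlim_opp_m_infty : filterlim Ropp (Rbar_locally m_infty) (Rbar_locally p_infty).
Proof. intros P [M HM]. exists (- M). intros x Hx. apply HM. lra. Qed.

(** Reflection changes the sign of [psi'] but not of [psi''], so only the drift term flips; the free
    boundary condition sees absolute values. *)
Lemma admissible_reflect (g c : R) (psi : R -> R) : admissible g c psi ->
  admissible g (- c) (fun x => psi (- x)).
Proof.
intros [psi_cont [psi_nonneg [[y Hy] [[z Hz] [psi_C2 [psi_eq psi_bd]]]]]].
assert (near : forall x, 0 < psi (- x) -> locally x (fun z => 0 < psi (- z))).
{ intros x Hx. apply (locally_reflect (fun z => 0 < psi z)).
  destruct (eps_continuous psi (- x) (psi_cont _) (psi (- x)) Hx) as [d [Hd H]].
  exists (mkposreal d Hd). intros w Hw. specialize (H w Hw).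
  apply Rabs_lt_between in H. lra. }
assert (D1 : forall x, 0 < psi (- x) -> is_derive (fun x => psi (- x)) x (- Derive psi (- x))).
{ intros x Hx. apply is_derive_reflect, Derive_correct, psi_C2, Hx. }
assert (D2 : forall x, 0 < psi (- x) ->
   is_derive (Derive (fun x => psi (- x))) x (Derive (Derive psi) (- x))).
{ intros x Hx. apply is_derive_ext_loc with (fun x => - Derive psi (- x)).
  - generalize (near x Hx). apply filter_imp. intros w Hw.
    symmetry. now apply is_derive_unique, D1.
  - rewrite <- (Ropp_involutive (Derive (Derive psi) (- x))).
    apply (is_derive_opp (fun x => Derive psi (- x))), is_derive_reflect, Derive_correct, psi_C2, Hx. }
split; [intros x; now apply continuous_reflect|].
split; [intros x; apply psi_nonneg|].
split; [exists (- y); now rewrite Ropp_involutive|].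
split; [exists (- z); now rewrite Ropp_involutive|].
split; [|split].
- intros x Hx. split; [eexists; now apply D1|]. split; [eexists; now apply D2|].
  apply continuous_ext_loc with (fun x => Derive (Derive psi) (- x)).
  + generalize (near x Hx). apply filter_imp. intros w Hw.
    symmetry. now apply is_derive_unique, D2.
  + apply continuous_reflect, psi_C2, Hx.
- intros x Hx. assert (E1 : Derive (fun x => psi (- x)) x = - Derive psi (- x)) by (now apply is_derive_unique, D1).
  assert (E2 : Derive (Derive (fun x => psi (- x))) x = Derive (Derive psi) (- x)) by (now apply is_derive_unique, D2).
  rewrite E1, E2.
  rewrite <- psi_eq by exact Hx. ring.
- intros x0 [Hcl Hint].
  assert (Hopp : forall x, Rabs (x - - x0) = Rabs (- x - x0)).
  { intros x. rewrite <- Rabs_Ropp. f_equal. ring. }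
  assert (Hbd : in_boundary psi (- x0)).
  { split.
    - intros eps He. destruct (Hcl eps He) as [x [Hx Hp]]. exists (- x).
      split; [|exact Hp]. now rewrite Hopp, Ropp_involutive.
    - intros [eps [He H]]. apply Hint. exists eps. split; [exact He|].
      intros x Hx. apply H. now rewrite Hopp, Ropp_involutive. }
  apply (filterlim_within_ext (posset (fun x => psi (- x)))
          (fun x => Rabs (Derive (fun y => pw (psi y) (1 / beta g)) (- x)))).
  + intros x Hx. unfold posset in Hx. rewrite <- Rabs_Ropp. f_equal. symmetry.
    apply is_derive_unique, (is_derive_reflect (fun y => pw (psi y) (1 / beta g))), Derive_correct.
    eexists. apply (is_derive_comp (fun y => pw y (1 / beta g)) psi).
    * now apply is_derive_pw.
    * now apply Derive_correct, psi_C2.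
  + apply (filterlim_comp _ _ _ Ropp
       (fun x => Rabs (Derive (fun y => pw (psi y) (1 / beta g)) x))
       _ (within (posset psi) (locally (- x0)))); [|now apply psi_bd].
    intros P HP. exact (locally_reflect (fun x => posset psi x -> P x) x0 HP).
Qed.

Lemma shape_minus_reflect (psi : R -> R) : shape_minus psi -> shape_plus (fun x => psi (- x)).
Proof.
intros [H1 H2]. split; [intros x Hx; apply H1; lra|].
intros x Hx. destruct (H2 (- x) ltac:(lra)) as [He Hd].
assert (D := is_derive_reflect psi x _ (Derive_correct _ _ He)).
split; [now exists (- Derive psi (- x))|]. apply is_derive_unique in D.
change (Derive (fun y => psi (- y)) x = - Derive psi (- x)) in D. rewrite D. lra.
Qed.

Lemma shape_plus_reflect (psi : R -> R) : shape_plus psi -> shape_minus (fun x => psi (- x)).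
Proof.
intros [H1 H2]. split; [intros x Hx; apply H1; lra|].
intros x Hx. destruct (H2 (- x) ltac:(lra)) as [He Hd].
assert (D := is_derive_reflect psi x _ (Derive_correct _ _ He)).
split; [now exists (- Derive psi (- x))|]. apply is_derive_unique in D.
change (Derive (fun y => psi (- y)) x = - Derive psi (- x)) in D. rewrite D. lra.
Qed.

Lemma asymp_plus_reflect (g c : R) (phi : R -> R) : asymp_plus g (- c) phi ->
  asymp_minus g c (fun x => phi (- x)).
Proof.
intros [H1 [H2 [H3 H4]]]. split; [|split; [|split]].
- exact (filterlim_comp _ _ _ Ropp phi _ _ _ filterlim_opp_m_infty H1).
- intros H x. apply H2. lra.
- intros H. destruct (H4 ltac:(lra)) as [k [Hk E]]. exists k. split; [exact Hk|].
  apply (filterlim_ext (fun x => phi (- x) / (k * exp (- - c * - x)))).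
  + intros x. do 3 f_equal. ring.
  + exact (filterlim_comp _ _ _ Ropp (fun x => phi x / (k * exp (- - c * x))) _ _ _ filterlim_opp_m_infty E).
- intros H. specialize (H3 ltac:(lra)).
  apply (filterlim_ext_loc (fun x => phi (- x) / pw (2 * g / (beta g * - c) * - x) (beta g / 2))).
  + exists 0. intros x Hx. now rewrite !Rabs_left by lra.
  + exact (filterlim_comp _ _ _ Ropp (fun x => phi x / pw (2 * g / (beta g * - c) * x) (beta g / 2))
             _ _ _ filterlim_opp_m_infty H3).
Qed.

(** * Uniqueness and classification *)

(** At the zero [0] the dichotomy leaves only the shift [l = 0]: every other alternative makes [psi]
    vanish on some [(0, r)], against its positive derivative there. *)
Lemma shape_plus_unique (g c : R) (phi : R -> R) : shape_plus phi ->
  (forall psi x0, admissible g c psi -> psi x0 = 0 ->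
    (forall x, x0 <= x -> psi x = 0) \/
    exists l, x0 <= l /\ forall x, x0 <= x -> psi x = phi (x - l)) ->
  forall psi, admissible g c psi -> shape_plus psi -> psi = phi.
Proof.
intros [phi_0 _] dich psi Hadm [psi_0 psi_incr].
assert (nonconstant : forall r, 0 < r -> ~ (forall x, 0 < x < r -> psi x = 0)).
{ intros r Hr H. destruct (psi_incr (r / 2) ltac:(lra)) as [_ Hd].
  rewrite (Derive_ext_loc psi (fun _ => 0)), Derive_const in Hd; [lra|].
  apply (locally_interval _ _ 0 r); simpl; [lra|lra|]. intros y Hy1 Hy2. now apply H. }
destruct (dich psi 0 Hadm (psi_0 0 (Rle_refl 0))) as [H|[l [Hl E]]].
- exfalso. apply (nonconstant 1 Rlt_0_1). intros x Hx. apply H. lra.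
- destruct (Rle_lt_or_eq_dec _ _ Hl) as [Hl'|Hl'].
  + exfalso. apply (nonconstant l Hl'). intros x Hx. rewrite E by lra. apply phi_0. lra.
  + subst l. apply functional_extensionality. intros x.
    destruct (Rle_lt_dec 0 x) as [Hx|Hx].
    * rewrite E by exact Hx. f_equal. ring.
    * rewrite psi_0, phi_0; lra.
Qed.

(** A zero [x0] of [psi] cuts the line in two. Each side carries zero or one half-line profile,
    anchored at [xm <= x0 <= xp]; both sides vanishing is excluded by nontriviality. *)
Theorem theorem7p2 (g : R) (hg : 0 < g <= 1) (c : R) :
  exists phip phim : R -> R,
    (admissible g c phip /\ shape_plus phip /\ asymp_plus g c phip /\
     forall psi, admissible g c psi -> shape_plus psi -> psi = phip) /\
    (admissible g c phim /\ shape_minus phim /\ asymp_minus g c phim /\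
     forall psi, admissible g c psi -> shape_minus psi -> psi = phim) /\
    (forall psi, admissible g c psi ->
       exists a b xp xm : R,
         (a = 0 \/ a = 1) /\ (b = 0 \/ b = 1) /\ a ^ 2 + b ^ 2 <> 0 /\
         xm <= xp /\
         forall x, psi x = a * phip (x - xp) + b * phim (x - xm)).
Proof.
destruct (increasing_profile_exists g c hg) as [phip [Ap [Sp [Lp dich_p]]]].
destruct (increasing_profile_exists g (- c) hg) as [phi [Am [Sm [Lm dich_m]]]].
exists phip, (fun x => phi (- x)). split; [|split].
- split; [exact Ap|]. split; [exact Sp|]. split; [exact Lp|].
  now apply shape_plus_unique.
- split; [|split; [|split]].
  + rewrite <- (Ropp_involutive c). now apply admissible_reflect.
  + now apply shape_plus_reflect.
  + now apply asymp_plus_reflect.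
  + intros psi Hadm Hs. apply functional_extensionality. intros x.
    rewrite <- (shape_plus_unique g (- c) phi Sm dich_m (fun x => psi (- x))).
    * now rewrite Ropp_involutive.
    * now apply admissible_reflect.
    * now apply shape_minus_reflect.
- intros psi Hadm. assert (Hadm' := Hadm).
  destruct Hadm' as [_ [psi_nonneg [[y Hy] [[x0 Hx0] _]]]].
  assert (H0 : psi x0 = 0) by (generalize (psi_nonneg x0); lra).
  destruct Sp as [phip_0 _]. destruct Sm as [phi_0 _].
  assert (L : (forall x, x <= x0 -> psi x = 0) \/
     exists l, l <= x0 /\ forall x, x <= x0 -> psi x = phi (- (x - l))).
  { destruct (dich_m (fun x => psi (- x)) (- x0)) as [H|[l [Hl E]]].
    - now apply admissible_reflect.
    - now rewrite Ropp_involutive.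
    - left. intros x Hx. rewrite <- (Ropp_involutive x). apply H. lra.
    - right. exists (- l). split; [lra|]. intros x Hx.
      rewrite <- (Ropp_involutive x) at 1. rewrite E by lra. f_equal. ring. }
  destruct (dich_p psi x0 Hadm H0) as [HR|[xp [Hxp ER]]];
    destruct L as [HL|[xm [Hxm EL]]].
  + exfalso. apply Hy. destruct (Rle_lt_dec x0 y); [apply HR|apply HL]; lra.
  (* The shift attached to a zero coefficient is arbitrary; taking both shifts equal secures
     [xm <= xp]. *)
  + exists 0, 1, xm, xm. repeat split; auto; try lra. intros x.
    destruct (Rle_lt_dec x x0).
    * rewrite EL by lra. ring.
    * rewrite HR, (phi_0 (- (x - xm))) by lra. ring.
  + exists 1, 0, xp, xp. repeat split; auto; try lra. intros x.
    destruct (Rle_lt_dec x0 x).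
    * rewrite ER by lra. ring.
    * rewrite HL, (phip_0 (x - xp)) by lra. ring.
  + exists 1, 1, xp, xm. repeat split; auto; try lra. intros x.
    destruct (Rle_lt_dec x0 x).
    * rewrite ER, (phi_0 (- (x - xm))) by lra. ring.
    * rewrite EL, (phip_0 (x - xp)) by lra. ring.
Qed.
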